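(* Let $d\ge 3$ be a fixed integer. Suppose $k=k(n)$ is a function of $n$, with positive integer values, satisfying $k\succ\sqrt n$. Fix $\epsilon>0$. Then $$\mathbb{P}_n\left[N_{simp}(k)\le \epsilon\cdot N_{prim}(k)\right]\to 1$$ as $n\to\infty$.
   Context: Asymptotics: $A\prec B$ (equivalently $B\succ A$) means $A=o(B)$, i.e. $A/B\to0$, as $n\to\infty$. When $d$ is odd, $n\to\infty$ along even integers only. Random model: $G(d,n)$ is the random $d$-regular multigraph on $n$ vertices given by the configuration model: attach $d$ half-edges to each of the $n$ vertices; repeatedly choose some unpaired half-edge and pair it with a different unpaired half-edge chosen uniformly at random, until all are paired (equivalently, take a uniformly random perfect matching of the $nd$ half-edges). Each pair is an edge; self-loops and multiple edges are allowed, and the result is still called a graph. $\mathbb{P}_n$ denotes probability with respect to $\Gamma$ drawn from $G(d,n)$. Each edge, including each self-loop, has two distinct orientations, so each vertex is the initial vertex of exactly $d$ oriented edges; $\overline e$ denotes the oriented edge $e$ with orientation reversed. Walks and loops: a walk of length $k$ is a sequence of oriented edges $e_1e_2\cdots e_k$ with the terminal vertex of $e_i$ equal to the initial vertex of $e_{i+1}$ for $1\le i\le k-1$. It is a loop if the terminal vertex of $e_k$ equals the initial vertex of $e_1$; two loops whose edge sequences differ by a cyclic shift are considered the same loop (a loop and its reversal are not identified). A walk is non-backtracking if $\overline{e_i}\ne e_{i+1}$ for $1\le i\le k-1$; a loop is non-backtracking if all walks associated to it (all cyclic shifts) are non-backtracking. A walk is simple if the terminal vertices of its edges are distinct, and a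 loop is simple if all (equivalently, any) of its associated walks are simple. A loop is primitive if it is not the repetition of a shorter loop. $N_{simp}(k)=N_{simp}(\Gamma,k)$ is the number of simple non-backtracking loops of length $k$ on $\Gamma$, and $N_{prim}(k)=N_{prim}(\Gamma,k)$ is the number of primitive non-backtracking loops of length $k$ on $\Gamma$. *)

(* Defs.v *)
From HB Require Import structures.
From mathcomp Require Import all_boot all_order all_algebra all_fingroup.
From mathcomp Require Import all_classical all_reals all_analysis.

Set Implicit Arguments.
Unset Strict Implicit.
Unset Printing Implicit Defensive.

Import Order.TTheory GRing.Theory Num.Theory.
Import numFieldNormedType.Exports.

Section Graph.
Variables n d : nat.

(* The half-edge [(v, i)] is identified with the oriented edge that leaves [v]
   through it; a self-loop at [v] consists of two half-edges at [v], which are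
   its two orientations. *)
Definition half_edge : finType := ('I_n * 'I_d)%type.

(* A perfect matching of the half-edges is encoded by the fixed-point-free
   involution that sends each half-edge to the one it is paired with. *)
Definition pairing : finType := {perm half_edge}.

Definition config_model : {set pairing} :=
  [set g : pairing | [forall h, (g (g h) == h) && (g h != h)]]%SET.

Variable g : pairing.

Definition initial (e : half_edge) : 'I_n := e.1.
Definition reversed (e : half_edge) : half_edge := g e.
Definition terminal (e : half_edge) : 'I_n := initial (reversed e).

Definition is_walk (w : seq half_edge) : bool :=
  sorted (fun e f => terminal e == initial f) w.

Definition is_closed_walk (w : seq half_edge) : bool :=
  if w is e :: s then is_walk w && (terminal (last e s) == initial e)
  else false.

Definition nonbacktracking (w : seq half_edge) : bool :=
  sorted (fun e f => reversed e != f) w.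

Definition simple (w : seq half_edge) : bool := uniq (map terminal w).

Section Loops.
Variable k : nat.

Definition cyclic_class (w : k.-tuple half_edge) : {set k.-tuple half_edge} :=
  [set rot_tuple i w | i : 'I_k]%SET.

(* A loop of length [k] is the set of the closed walks associated to it. *)
Definition loops : {set {set k.-tuple half_edge}} :=
  [set cyclic_class w | w : k.-tuple half_edge & is_closed_walk w]%SET.

Definition nonbacktracking_loop (l : {set k.-tuple half_edge}) : bool :=
  [forall w in l, nonbacktracking w].

Definition simple_loop (l : {set k.-tuple half_edge}) : bool :=
  [forall w in l, simple w].

(* The bound [r <= k] on the number of repetitions loses nothing, since
   closed walks are nonempty; it only keeps the quantifier finite. *)
Definition repetition_of_shorter (w : k.-tuple half_edge) : bool :=
  [exists j : 'I_k, exists u : j.-tuple half_edge, exists r : 'I_k.+1,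
     is_closed_walk u && (tval w == flatten (nseq r (tval u)))].

Definition primitive_loop (l : {set k.-tuple half_edge}) : bool :=
  [forall w in l, ~~ repetition_of_shorter w].

Definition N_simp : nat :=
  #|[set l in loops | nonbacktracking_loop l && simple_loop l]%SET|.

Definition N_prim : nat :=
  #|[set l in loops | nonbacktracking_loop l && primitive_loop l]%SET|.

End Loops.
End Graph.

Arguments config_model : clear implicits.

Local Open Scope ring_scope.

(* Probability under the uniform distribution on [config_model n d]. *)
Definition config_prob (R : realType) (n d : nat) (E : pred (pairing n d)) : R :=
  #|[set g in config_model n d | E g]%SET|%:R / #|config_model n d|%:R.

Definition admissible (d n : nat) : bool := odd d ==> ~~ odd n.

(* The filter of [n --> oo] along the admissible [n]. *)
Definition admissible_oo (d : nat) : set_system nat :=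
  within [set n | admissible d n]%classic \oo%classic.

(* Main.v *)
Require Import Defs.
From mathcomp Require Import all_classical all_reals all_analysis.
From mathcomp Require Import all_boot all_order all_algebra all_fingroup.
From mathcomp Require Import zify ring lra.
Import Order.TTheory GRing.Theory Num.Theory.
Import numFieldNormedType.Exports.

(** Write [N = n d] for the number of half-edges and [D = d - 1]: a
    non-backtracking walk continues in [D] ways from every oriented edge.  A
    loop of length [k] is represented by at most [k] closed walks, by exactly
    [k] if it is simple, and the scale on which these closed walks have to be
    counted is [D ^ k].  With high probability [k * N_prim] is at least a
    quarter of [D ^ k], and [k * N_simp] is a negligible fraction of [D ^ k] as
    soon as [k] is much larger than the square root of [n].

    The randomness enters through a single principle, [fresh_step]: as long as
    only the partners of the half-edges of a list [ex] have been looked at, the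
    partner of an unseen half-edge is uniform on the unseen half-edges, of which
    there are at least [N - 2 |ex| - 1].

    Simple loops.  After [m] steps a simple walk has to avoid [m + 1] vertices,
    that is [d (m + 1)] half-edges, while only [2 m + 1] half-edges have been
    seen.  As [d >= 3], the step succeeds with probability at most
    [1 - (m + 2) / N] ([sum_simple_count_decay]).  The product of these
    factors over [k] steps is [O (n / k ^ 2)], and closing up the walk costs
    a further factor of order [1 / n], which cancels the choice of the starting
    edge ([sum_N_simp]).

    Primitive loops.  Let [P] be the transition matrix of the non-backtracking
    random walk on oriented edges.  It is doubly stochastic, and the number of
    cyclically non-backtracking closed walks of length [k] is [D ^ k] times the
    trace of [P ^ k].  Let [q <= P ^ m] be the contribution of the walks that
    never repeat a vertex.  If [q] is close to the uniform matrix [1 / N] in the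
    Hilbert-Schmidt norm, then so is the trace of [q q P ^ (k - 2 m)] to [1]:
    this is the elementary inequality [trace_bound].  The distance from [q] to
    the uniform matrix is controlled in mean by two first moments.

    - The entries of [q] sum to nearly [N], because a walk of [m] steps, with
      [m ^ 2] much smaller than [n], is simple with high probability
      ([sum_simple_count_ge]).
    - The squares of its entries sum to at most [1 + o(1)], because two simple
      walks with the same first and the same last edge either agree in their
      last two edges, or come from distinct edges into the same vertex; the
      latter is a fresh step into a prescribed vertex.  This gives a linear
      recursion in [m] ([pair_countS], [meeting_count]); its coefficients are
      exact enough for the solution to have leading constant [1]
      ([sum_pair_count]).

    Markov's inequality turns this into a lower bound of [D ^ k / 2] for the
    number of closed walks with high probability.  At most
    [k N D ^ (k / 2)] walks are repetitions of shorter ones ([card_repetitions]),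
    so that nearly all these loops are primitive.  Taking for [m] the integer
    part of the fourth root of [n] makes all error terms small. *)

Set Implicit Arguments.
Unset Strict Implicit.
Unset Printing Implicit Defensive.

(** * Sums over tuples and numbers of paths *)

Lemma sum_bool_card (I : finType) (A : {set I}) (P : pred I) :
  \sum_(i in A) (P i : nat) = #|[set i in A | P i]|.
Proof.
rewrite -sum1_card big_mkcond [RHS]big_mkcond; apply: eq_bigr => i _.
by rewrite inE; case: (i \in A); case: (P i).
Qed.

Lemma sum_bool_cardT (I : finType) (P : pred I) :
  \sum_i (P i : nat) = #|[set i | P i]|.
Proof.
rewrite -sum1dep_card [RHS]big_mkcond; apply: eq_bigr => i _.
by case: (P i).
Qed.

Section PathCount.
Variable T : finType.

Lemma sum_tuple_cons m (F : seq T -> nat) :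
  \sum_(s : m.+1.-tuple T) F s = \sum_y \sum_(s : m.-tuple T) F (y :: s).
Proof.
rewrite pair_big /=.
rewrite (reindex (fun p : T * m.-tuple T => [tuple of p.1 :: p.2])) //=.
exists (fun s : m.+1.-tuple T => (thead s, [tuple of behead s])) => [[y s] _ | s _].
  by congr pair; apply: val_inj.
by rewrite [RHS]tuple_eta.
Qed.

Lemma sum_tuple0 (F : seq T -> nat) : \sum_(s : 0.-tuple T) F s = F [::].
Proof.
rewrite (big_pred1 [tuple]) // => s.
by rewrite [s]tuple0 /= eqxx.
Qed.

Variable r : rel T.

Definition path_count m x y :=
  \sum_(s : m.-tuple T) (path r x s && (last x s == y) : nat).

Lemma path_count0 x y : path_count 0 x y = (x == y).
Proof. exact: (sum_tuple0 (fun s => path r x s && (last x s == y) : nat)). Qed.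

Lemma path_countS m x y :
  path_count m.+1 x y = \sum_z r x z * path_count m z y.
Proof.
rewrite /path_count (sum_tuple_cons _ (fun s => path r x s && (last x s == y) : nat)).
apply: eq_bigr => z _; rewrite big_distrr; apply: eq_bigr => s _ /=.
by rewrite -andbA mulnb.
Qed.

Lemma path_countD a b x y :
  path_count (a + b) x y = \sum_z path_count a x z * path_count b z y.
Proof.
elim: a x => [|a IHa] x.
  rewrite (bigD1 x) //= path_count0 eqxx mul1n big1 ?addn0 // => z zx.
  by rewrite path_count0 eq_sym (negbTE zx).
rewrite addSn path_countS.
under [RHS]eq_bigr => z _ do rewrite path_countS big_distrl /=.
rewrite exchange_big; apply: eq_bigr => z _.
by rewrite IHa big_distrr /=; apply: eq_bigr => u _; rewrite mulnA.
Qed.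

Variable D : nat.

Lemma path_count_row m x :
  (forall x, \sum_z (r x z : nat) = D) -> \sum_y path_count m x y = D ^ m.
Proof.
move=> rowD; elim: m x => [|m IHm] x.
  rewrite (bigD1 x) //= path_count0 eqxx big1 // => y yx.
  by rewrite path_count0 eq_sym (negbTE yx).
under eq_bigr => y _ do rewrite path_countS.
rewrite exchange_big expnS /=.
under eq_bigr => z _ do rewrite -big_distrr /= IHm.
by rewrite -big_distrl /= rowD.
Qed.

Lemma path_count_col m y :
  (forall z, \sum_x (r x z : nat) = D) -> \sum_x path_count m x y = D ^ m.
Proof.
move=> colD; elim: m => [|m IHm].
  rewrite (bigD1 y) //= path_count0 eqxx big1 // => x xy.
  by rewrite path_count0 (negbTE xy).
under eq_bigr => x _ do rewrite path_countS.
rewrite exchange_big expnS /= -IHm big_distrr /=.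
by apply: eq_bigr => z _; rewrite -big_distrl /= colD.
Qed.

Lemma sum_path m x :
  (forall x, \sum_z (r x z : nat) = D) ->
  \sum_(s : m.-tuple T) (path r x s : nat) = D ^ m.
Proof.
move=> rowD; rewrite -(path_count_row m x rowD) exchange_big /=.
apply: eq_bigr => s _; rewrite (bigD1 (last x s)) //= eqxx andbT.
by rewrite big1 ?addn0 // => y; rewrite eq_sym => /negbTE ->; rewrite andbF.
Qed.

Lemma sum_path_to m y :
  (forall z, \sum_x (r x z : nat) = D) ->
  \sum_x \sum_(s : m.-tuple T) (path r x s && (last x s == y) : nat) = D ^ m.
Proof. exact: path_count_col. Qed.

End PathCount.

Lemma sum_tuple_rev (T : finType) k (F : seq T -> nat) :
  \sum_(w : k.-tuple T) F w = \sum_(w : k.-tuple T) F (rev w).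
Proof.
rewrite (reindex_inj (h := fun w : k.-tuple T => [tuple of rev w])) //.
by move=> v w /(congr1 val) /= /(can_inj revK) vw; apply: val_inj.
Qed.

(** * Exposing a uniform perfect matching *)

Section ConfigModel.
Variables n d : nat.
Notation E := (half_edge n d).
Notation N := #|{: E}|.
Notation C := (config_model n d).
Notation vertices s := (map (@initial n d) s).

Lemma card_half_edge : N = (n * d)%N.
Proof. by rewrite card_prod !card_ord. Qed.

Lemma config_modelP (g : pairing n d) :
  reflect (involutive g /\ forall h, g h != h) (g \in config_model n d).
Proof.
rewrite inE; apply: (iffP forallP) => [gP|[gK gF] h].
  by split=> h; have /andP[/eqP] := gP h.
by rewrite gK eqxx gF.
Qed.

(** The switching argument: conjugating [g] by the transposition of [x] and
    an unseen half-edge [y] moves the partner of [h] from [x] to [y] and changes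
    no partner of a member of [ex].  The pair [(g, y)] can be recovered from the
    result, as [y] is the new partner of [h]. *)
Lemma fresh_step (W : pred (pairing n d)) (ex : seq E) (h x : E) :
  (forall g g' : pairing n d, {in ex, g =1 g'} -> W g -> W g') ->
  #|[set g in config_model n d |
      [&& W g, h \notin ex, h \notin map g ex & g h == x]]|
    * (N - (2 * size ex).+1)
  <= #|[set g in config_model n d | W g]|.
Proof.
move=> Wloc; set A := [set g in _ | _].
pose seen (g : pairing n d) := h :: ex ++ map g ex.
pose Z := [set gy : pairing n d * E | (gy.1 \in A) && (gy.2 \notin seen gy.1)].
have ZA : #|A| * (N - (2 * size ex).+1) <= #|Z|.
  rewrite [#|Z|](_ : _ = \sum_(g in A) #|[set y | y \notin seen g]|); last first.
    rewrite -sum1dep_card (eq_bigl (fun gy => (gy.1 \in A) && (gy.2 \notin seen gy.1))) //.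
    rewrite -(pair_big_dep (mem A) (fun g y => y \notin seen g) (fun _ _ => 1)) /=.
    by apply: eq_bigr => g _; rewrite -sum1dep_card.
  rewrite -sum_nat_const; apply: leq_sum => g _.
  rewrite cardsCs.
  have -> : ~: [set y | y \notin seen g] = [set y in seen g].
    by apply/setP => y; rewrite !inE negbK.
  have le : #|[set y in seen g]| <= (2 * size ex).+1.
    by rewrite cardsE (leq_trans (card_size _)) //= size_cat size_map mul2n addnn.
  by rewrite leq_sub2l.
apply: (leq_trans ZA).
pose phi (gy : pairing n d * E) : pairing n d := (gy.1 ^ tperm x gy.2)%g.
have phih g y : (g, y) \in Z -> phi (g, y) h = y.
  rewrite inE /= inE => /andP[/andP[gC /and4P[_ _ _ /eqP gh]]].
  rewrite inE negb_or => /andP[yh _].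
  rewrite /phi conjgE tpermV !permM /=.
  rewrite (@tpermD _ x y h) ?gh ?tpermL //.
  by have [_ /(_ h)] := config_modelP _ gC; rewrite gh.
have phi_inj : {in Z &, injective phi}.
  move=> [g y] [g' y'] zg zg' eqphi.
  have yy' : y = y' by rewrite -(phih g y) // eqphi phih.
  by move: eqphi; rewrite yy' /phi /= => /conjg_inj ->.
rewrite -(card_in_imset phi_inj); apply: subset_leq_card.
apply/fintype.subsetP => _ /imsetP[[g y] zg ->].
have /andP[] : (g \in A) && (y \notin seen g) by move: zg; rewrite inE.
move=> /setIdP[gC /and4P[Wg hex hgex /eqP gh]] yseen.
have /and3P[yh yex ygex] : [&& y != h, y \notin ex & y \notin map g ex].
  by move: yseen; rewrite inE mem_cat !negb_or.
have [gK gF] := config_modelP _ gC.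
rewrite inE; apply/andP; split.
  apply/config_modelP; rewrite /phi conjgE tpermV; split=> z; rewrite !permM /=.
    by rewrite tpermK gK tpermK.
  by apply/eqP => /(congr1 (tperm x y)); rewrite tpermK; apply/eqP/gF.
apply: Wloc Wg => e eex; rewrite /phi conjgE tpermV !permM /=.
have hx : h = g x by rewrite -gh gK.
rewrite (@tpermD _ x y e) ?(@tpermD _ x y (g e)) //.
- by rewrite -gh (inj_eq perm_inj); apply: contraNneq hex => ->.
- by apply: contraNneq ygex => ->; apply: map_f.
- by apply: contraNneq hgex => xe; rewrite hx xe map_f.
- by apply: contraNneq yex => ->.
Qed.

(** The half-edges are numbered, and those numbered [2 i] and [2 i + 1] are
    paired. *)
Lemma config_model_gt0 : ~~ odd (n * d) -> 0 < #|C|.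
Proof.
move=> evenN.
pose mate (i : nat) := if odd i then i.-1 else i.+1.
have mateK : involutive mate.
  move=> i; rewrite /mate; case oi: (odd i); last by rewrite /= oi.
  by case: i oi => //= i /negbTE ->.
have mateN i : i < N -> mate i < N.
  rewrite card_half_edge /mate; case: ifP => oi iN; first by apply: leq_ltn_trans iN; exact: leq_pred.
  rewrite ltn_neqAle iN andbT; apply: contraNneq evenN => <-.
  by rewrite /= oi.
pose f (h : E) : E := enum_val (Ordinal (mateN _ (ltn_ord (enum_rank h)))).
have fK : involutive f.
  move=> h; rewrite /f; apply: (can_inj (@enum_rankK _)); rewrite enum_valK.
  by apply: val_inj; rewrite /= enum_valK /= mateK.
apply/card_gt0P; exists (perm (can_inj fK)); apply/config_modelP; split=> h; rewrite !permE //.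
apply/eqP => /(congr1 enum_rank); rewrite /f enum_valK => /(congr1 val) /=.
by rewrite /mate; case: ifP => oi; [case: (nat_of_ord _) oi => // i _ /=|]; lia.
Qed.

(** The set [X] of targets may depend on what has been seen, which makes it
    possible to exclude the half-edge by which a vertex was entered. *)
Lemma fresh_set (W : pred (pairing n d)) (X : pairing n d -> {set E}) c
    (ex : seq E) (h : E) :
  (forall g g' : pairing n d, {in ex, g =1 g'} -> W g -> W g') ->
  (forall g g' : pairing n d, {in ex, g =1 g'} -> X g = X g') ->
  (forall g, g \in C -> W g -> #|X g| <= c) ->
  #|[set g in C | [&& W g, h \notin ex, h \notin map g ex & g h \in X g]]|
    * (N - (2 * size ex).+1)
  <= c * #|[set g in C | W g]|.
Proof.
move=> Wloc Xloc Xc.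
have -> : #|[set g in C | [&& W g, h \notin ex, h \notin map g ex & g h \in X g]]|
  = \sum_x #|[set g in C | [&& W g && (x \in X g), h \notin ex,
                              h \notin map g ex & g h == x]]|.
  rewrite -sum_bool_card.
  under [RHS]eq_bigr => x _ do rewrite -sum_bool_card.
  rewrite exchange_big; apply: eq_bigr => g _.
  rewrite (bigD1 (g h)) //= eqxx andbT big1 ?addn0 => [|x /negbTE].
    by case: (W g); case: (g h \in X g); rewrite /= ?andbT ?andbF.
  by rewrite eq_sym => ->; rewrite !andbF.
rewrite big_distrl /=.
apply: (@leq_trans (\sum_x #|[set g in C | W g && (x \in X g)]|)).
  apply: leq_sum => x _; apply: fresh_step => g g' gg' /andP[Wg xg].
  by rewrite (Wloc g) //= -(Xloc g).
under eq_bigr => x _ do rewrite -sum_bool_card.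
rewrite exchange_big -sum_bool_card big_distrr /=; apply: leq_sum => g gC.
case Wg: (W g) => /=; last by rewrite big1.
by rewrite muln1 (leq_trans _ (Xc g gC Wg)) // sum_bool_cardT cardsE.
Qed.

(** * Non-backtracking walks and simple walks *)

(** The first argument is the later edge: walks are stored with their latest
    edge first, so that a further step is a [cons]. *)
Definition follows (g : pairing n d) (f e : E) : bool :=
  (terminal g e == initial f) && (reversed g e != f).

Definition simple_walk (g : pairing n d) (x : E) (s : seq E) : bool :=
  path (follows g) x s && uniq (vertices (x :: s)).

Lemma card_half_edges_at (P : pred 'I_n) :
  #|[set x : E | P (initial x)]| = d * #|[set v | P v]|.
Proof.
rewrite mulnC -[d in RHS]card_ord -cardsT -cardsX.
by apply: eq_card => -[v i]; rewrite !inE /= andbT.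
Qed.

Lemma card_half_edges_at1 (v : 'I_n) : #|[set x : E | initial x == v]| = d.
Proof.
rewrite (card_half_edges_at (pred1 v)) (_ : [set _ | _] = [set v]) ?cards1 ?muln1 //.
by apply/setP => u; rewrite !inE.
Qed.

Lemma card_other_half_edges (y : E) :
  #|[set x : E | (initial x == initial y) && (x != y)]| = d.-1.
Proof.
have := card_half_edges_at1 (initial y); rewrite (cardsD1 y) inE eqxx add1n => /(congr1 predn) /= eqd.
rewrite -[RHS]eqd.
by apply: eq_card => x; rewrite !inE andbC.
Qed.

Lemma sum_follows g y : \sum_x (follows g x y : nat) = d.-1.
Proof.
rewrite -(card_other_half_edges (g y)) sum_bool_cardT; apply: eq_card => x.
by rewrite !inE /follows /terminal /reversed ![_ == g y]eq_sym [initial x == _]eq_sym.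
Qed.

Lemma sum_followed g x : g \in C -> \sum_y (follows g x y : nat) = d.-1.
Proof.
move=> /config_modelP[gK _].
rewrite -(card_other_half_edges x) sum_bool_cardT -[RHS](card_imset _ (@perm_inj _ g)).
apply: eq_card => y; apply/idP/imsetP => [|[z]]; last first.
  by rewrite inE => zP ->; rewrite inE /follows /terminal /reversed gK.
by rewrite inE => yP; exists (g y); rewrite ?gK // inE.
Qed.

Lemma follows_local (g g' : pairing n d) f e : g e = g' e -> follows g f e = follows g' f e.
Proof. by rewrite /follows /terminal /reversed => ->. Qed.

Lemma path_follows_local (g g' : pairing n d) x s :
  {in s, g =1 g'} -> path (follows g) x s = path (follows g') x s.
Proof.
elim: s x => //= y s IHs x gg'; rewrite (follows_local _ (gg' y _)) ?mem_head //.
by rewrite IHs // => z zs; rewrite gg' // inE zs orbT.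
Qed.

Lemma simple_walk_local (g g' : pairing n d) x s :
  {in s, g =1 g'} -> simple_walk g x s = simple_walk g' x s.
Proof. by move=> gg'; rewrite /simple_walk (path_follows_local _ gg'). Qed.

Lemma simple_walk_cons g x y s :
  simple_walk g x (y :: s) =
  [&& follows g x y, simple_walk g y s & terminal g y \notin vertices (y :: s)].
Proof.
rewrite /simple_walk /= /follows.
case: (eqVneq (terminal g y) (initial x)) => //= ->.
by case: (_ != x) => //=; rewrite -!andbA; do !bool_congr.
Qed.

(** The latest edge [x] of a simple walk has an unseen partner: if [x] were
    the reversal of an earlier edge, its initial vertex would have been visited
    before, or the last step would backtrack. *)
Lemma simple_walk_fresh g x s : g \in C -> simple_walk g x s ->
  (x \notin s) && (x \notin map g s).
Proof.
move=> /config_modelP[gK _] /andP[xs]; rewrite cons_uniq => /andP[xvs vs].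
apply/andP; split; first by apply: contraNN xvs; apply: map_f.
case: s xs xvs vs => //= y s /andP[xy ys].
rewrite !inE negb_or => /andP[xvy xvs] /andP[yvs vs].
have /andP[/eqP ty ryx] := xy.
rewrite negb_or [x == _]eq_sym ryx /=.
elim: s y {xy ty ryx} ys xvy xvs yvs vs => //= z s IHs y /andP[/andP[/eqP yz _] zs] xvy.
rewrite !inE !negb_or => /andP[xz xs] /andP[_ _] /andP[zvs vs].
rewrite (IHs z) // andbT; apply: contraNneq xvy => ->.
by rewrite -yz.
Qed.

(** * First moments of simple walks and of pairs of simple walks *)

Definition simple_count (g : pairing n d) m :=
  \sum_x \sum_(s : m.-tuple E) (simple_walk g x s : nat).

(** With [s] and [t] the pasts of two walks whose latest edge is [x], this is
    the sum of the squares of the numbers of simple walks between two given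
    edges. *)
Definition pair_count (g : pairing n d) m :=
  \sum_x \sum_(s : m.-tuple E) \sum_(t : m.-tuple E)
    ([&& simple_walk g x s, simple_walk g x t & last x s == last x t] : nat).

Lemma simple_count0 g : simple_count g 0 = N.
Proof.
rewrite /simple_count (eq_bigr (fun _ => 1)) ?sum1_card // => x _.
exact: (sum_tuple0 (fun s => simple_walk g x s : nat)).
Qed.

Lemma pair_count0 g : pair_count g 0 = N.
Proof.
rewrite /pair_count (eq_bigr (fun _ => 1)) ?sum1_card // => x _.
rewrite (sum_tuple0 (fun s => \sum_(t : 0.-tuple E)
  ([&& simple_walk g x s, simple_walk g x t & last x s == last x t] : nat))).
rewrite (sum_tuple0 (fun t =>
  ([&& simple_walk g x [::], simple_walk g x t & last x [::] == last x t] : nat))).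
by rewrite /= eqxx.
Qed.

Lemma simple_count_le g m : g \in C -> simple_count g m <= N * d.-1 ^ m.
Proof.
move=> gC; rewrite /simple_count -sum_nat_const; apply: leq_sum => x _.
rewrite -(@sum_path _ (follows g) d.-1 m x) => [|z]; last exact: sum_followed.
by apply: leq_sum => s _; rewrite /simple_walk; case: path => //=; case: (_ && _).
Qed.

(** One more step of a simple walk, into a set of at most [c] vertices that
    may depend on the walk. *)
Lemma simple_walk_step m c (a : E -> seq E -> pred 'I_n) :
  (forall y (s : m.-tuple E), uniq (vertices (y :: s)) ->
     #|[set v | a y s v]| <= c) ->
  (\sum_(g in C) \sum_y \sum_(s : m.-tuple E)
     (simple_walk g y s && a y s (terminal g y) : nat)) * (N - (2 * m).+1)
  <= d * c * \sum_(g in C) simple_count g m.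
Proof.
move=> ac; rewrite /simple_count exchange_big [X in _ <= _ * X]exchange_big /=.
rewrite big_distrl big_distrr; apply: leq_sum => y _ /=.
rewrite exchange_big [X in _ <= _ * X]exchange_big /=.
rewrite big_distrl big_distrr; apply: leq_sum => s _ /=.
rewrite !sum_bool_card.
have := @fresh_set (fun g => simple_walk g y s)
  (fun _ => [set x | a y s (initial x)]) (d * c) s y.
rewrite size_tuple => /(_ _ _ _)/(leq_trans _); apply => //.
- rewrite leq_mul2r; apply/orP; right; apply: subset_leq_card.
  apply/fintype.subsetP => g /setIdP[gC /andP[ys ag]]; apply/setIdP; split=> //.
  have /andP[ys1 ys2] := simple_walk_fresh gC ys.
  by rewrite ys ys1 ys2 inE.
- by move=> g g' gg'; rewrite (simple_walk_local _ gg').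
- move=> g gC /andP[_ us]; rewrite (card_half_edges_at (a y s)) leq_mul2l; apply/orP; right.
  exact: ac.
Qed.

Lemma simple_countS g m : g \in C ->
  simple_count g m.+1 = d.-1 * \sum_y \sum_(s : m.-tuple E)
     (simple_walk g y s && (terminal g y \notin vertices (y :: s)) : nat).
Proof.
move=> gC; rewrite /simple_count.
under eq_bigr => x _ do rewrite (sum_tuple_cons _ (fun s => simple_walk g x s : nat)).
rewrite exchange_big big_distrr; apply: eq_bigr => y _ /=.
rewrite -(sum_follows g y) big_distrl; apply: eq_bigr => x _ /=.
rewrite big_distrr; apply: eq_bigr => s _ /=.
by rewrite simple_walk_cons mulnb.
Qed.

Lemma card_vertices (s : seq E) : uniq (vertices s) ->
  #|[set v in vertices s]| = size s.
Proof. by move=> us; rewrite cardsE (card_uniqP us) size_map. Qed.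

(** The fresh step has to avoid the [m + 1] vertices already visited. *)
Lemma simple_count_decay m :
  (\sum_(g in C) simple_count g m.+1) * (N - (2 * m).+1)
  <= d.-1 * (d * (n - m.+1)) * \sum_(g in C) simple_count g m.
Proof.
under eq_bigr => g gC do rewrite simple_countS //.
rewrite -big_distrr -!mulnA leq_mul2l mulnA; apply/orP; right.
apply: (@simple_walk_step m _ (fun y s v => v \notin vertices (y :: s))) => y s us.
rewrite cardsCs (_ : ~: _ = [set v in vertices (y :: s)]).
  by rewrite card_vertices //= size_tuple card_ord.
by apply/setP => v; rewrite !inE negbK.
Qed.

(** A walk that ceases to be simple at its next step makes a fresh step into
    one of the [m + 1] vertices it has visited. *)
Lemma simple_count_grow m K : K <= N - (2 * m).+1 ->
  d.-1 * (\sum_(g in C) simple_count g m) * K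
  <= (\sum_(g in C) simple_count g m.+1) * K
     + d.-1 * (d * m.+1) * \sum_(g in C) simple_count g m.
Proof.
move=> leK.
set H := \sum_(g in C) \sum_y \sum_(s : m.-tuple E)
     (simple_walk g y s && (terminal g y \in vertices (y :: s)) : nat).
have -> : d.-1 * (\sum_(g in C) simple_count g m) =
    \sum_(g in C) simple_count g m.+1 + d.-1 * H.
  rewrite !big_distrr -big_split /=; apply: eq_bigr => g gC.
  rewrite simple_countS // -mulnDr -big_split; congr (_ * _); apply: eq_bigr => y _ /=.
  rewrite -big_split; apply: eq_bigr => s _ /=.
  by case: simple_walk => //=; case: (_ \in _).
rewrite mulnDl leq_add2l -!mulnA leq_mul2l mulnA; apply/orP; right.
apply: (leq_trans (leq_mul (leqnn H) leK)).
apply: (@simple_walk_step m _ (fun y s v => v \in vertices (y :: s))) => y s us.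
by rewrite card_vertices //= size_tuple.
Qed.

Lemma sum_simple_closed m :
  (\sum_(g in C) \sum_y \sum_(s : m.-tuple E)
     (simple_walk g y s && (terminal g y == initial (last y s)) : nat))
    * (N - (2 * m).+1) <= d * \sum_(g in C) simple_count g m.
Proof.
have := @simple_walk_step m 1 (fun y s v => v == initial (last y s)).
rewrite muln1; apply => y s _.
by rewrite (_ : [set v | _] = [set initial (last y s)]) ?cards1 //; apply/setP => v; rewrite !inE.
Qed.

(** Two simple walks whose latest edges [y] and [z] differ but lead to the
    same vertex, through which neither has passed before: when all of the first
    walk and the past of the second are exposed, [z] is still unseen. *)
Lemma simple_walk_meet g x y z s t : g \in C -> y != z ->
  simple_walk g x (y :: s) -> simple_walk g x (z :: t) ->
  (z \notin y :: s ++ t) && (z \notin map g (y :: s ++ t)).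
Proof.
move=> gC yz; rewrite !simple_walk_cons => /and3P[xy ys ty] /and3P[xz zt tz].
have /andP[zt1 zt2] := simple_walk_fresh gC zt.
have [gK _] := config_modelP _ gC.
have tyz : terminal g y = terminal g z.
  by move: xy xz => /andP[/eqP-> _] /andP[/eqP-> _].
rewrite map_cons map_cat !inE !mem_cat !negb_or zt1 zt2 eq_sym yz !andbT /=.
move: ty; rewrite tyz => {tyz xy xz zt zt1 zt2 t tz} ty.
have zg : z \notin map g (y :: s).
  apply: contraNN ty => /mapP[w ws zw]; apply/mapP; exists w => //.
  by rewrite /terminal /reversed zw gK.
move: zg; rewrite inE negb_or => /andP[-> ->]; rewrite andbT.
move: ys => /andP[+ _].
elim: s y ty yz => // w s IHs y ty yz /= /andP[yw ws].
move: ty; rewrite map_cons inE negb_or => /andP[ty tw].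
have wz : w != z.
  apply: contraNneq ty => <-; by case/andP: yw.
by rewrite inE negb_or eq_sym wz (IHs w).
Qed.

Lemma sum_follows2 (g : pairing n d) (y z : E) : y != z -> terminal g y = terminal g z ->
  \sum_x (follows g x y && follows g x z : nat) = d.-2.
Proof.
move=> yz tyz; rewrite sum_bool_cardT.
have := card_other_half_edges (g y); rewrite (cardsD1 (g z)).
have -> : g z \in [set x | (initial x == initial (g y)) && (x != g y)].
  by rewrite inE (inj_eq perm_inj) [z == y]eq_sym yz andbT; apply/eqP.
rewrite add1n => /(congr1 predn) /= eqd.
rewrite -[RHS]eqd; apply: eq_card => x.
rewrite !inE /follows -tyz /reversed ![x == _]eq_sym [initial x == _]eq_sym.
rewrite -/(terminal g y).
by case: (terminal g y == _); rewrite /= ?andbF // andbC.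
Qed.

(** The situation of [simple_walk_meet], relaxed to conditions that depend
    only on the partners of the exposed half-edges, apart from the last step
    itself. *)
Definition meeting (g : pairing n d) m (y z : E) (s t : m.-tuple E) :=
  [&& path (follows g) y s, path (follows g) z t, last y s == last z t,
      y != z, terminal g y == terminal g z,
      z \notin y :: s ++ t & z \notin map g (y :: s ++ t)].

(** The latest edges [y] and [z] before the common edge [x] are equal, and
    then [x] is one of [d - 1] successors of [y]; or they are different and
    meet, and then [x] is one of the [d - 2] half-edges at the meeting vertex
    other than their partners. *)
Lemma pair_countS g m : g \in C ->
  pair_count g m.+1 <= d.-1 * pair_count g m + d.-2 *
    \sum_y \sum_(s : m.-tuple E) \sum_z \sum_(t : m.-tuple E)
       (meeting g y z s t : nat).
Proof.
move=> gC; rewrite /pair_count.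
under eq_bigr => x _.
  rewrite (sum_tuple_cons _ (fun s => \sum_(t : m.+1.-tuple E)
    ([&& simple_walk g x s, simple_walk g x t & last x s == last x t] : nat))).
  under eq_bigr => y _.
    under eq_bigr => s _ do rewrite (sum_tuple_cons _ (fun t =>
      ([&& simple_walk g x (y :: s), simple_walk g x t & last x (y :: s) == last x t] : nat))).
    over.
  over.
rewrite exchange_big [X in _ <= X + _]big_distrr [X in _ <= _ + X]big_distrr -big_split /=.
apply: leq_sum => y _.
rewrite exchange_big [X in _ <= X + _]big_distrr [X in _ <= _ + X]big_distrr -big_split /=.
apply: leq_sum => s _.
rewrite exchange_big (bigD1 y) //=.
apply: leq_add.
  rewrite exchange_big big_distrr; apply: leq_sum => t _ /=.
  rewrite -(sum_follows g y) big_distrl; apply: leq_sum => x _ /=.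
  rewrite !simple_walk_cons; case: follows => //=.
  rewrite mul1n; case: (simple_walk g y s); case: (simple_walk g y t);
    rewrite ?andbF //=.
  by case: (last y s == last y t); rewrite ?andbF ?leq_b1.
rewrite big_distrr [X in _ <= X](bigD1 y) //=; apply: leq_trans (leq_addl _ _).
apply: leq_sum => z zy; rewrite exchange_big big_distrr; apply: leq_sum => t _ /=.
have [/eqP tyz|tyz] := boolP (terminal g y == terminal g z); last first.
  rewrite big1 // => x _; apply/eqP; rewrite eqb0; apply: contraNN tyz.
  rewrite !simple_walk_cons => /and3P[/and3P[/andP[/eqP-> _] _ _] /and3P[/andP[/eqP-> _] _ _] _] //.
have yz : y != z by rewrite eq_sym.
rewrite -(@sum_follows2 g y z) // big_distrl; apply: leq_sum => x _ /=.
case: (boolP [&& _, _ & _]) => // /and3P[ys zt st].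
have /andP[zex zgex] := simple_walk_meet gC yz ys zt.
move: ys zt; rewrite !simple_walk_cons => /and3P[xy /andP[ys _] _] /and3P[xz /andP[zt _] _].
by rewrite /meeting xy xz ys zt st yz tyz eqxx zex zgex.
Qed.

(** Once the walks are given, a meeting is a fresh step of [z] into one of
    the [d - 1] half-edges at the terminal vertex of [y] other than the partner of
    [y].  The number of pairs
    of walks is that of all pairs of non-backtracking walks with the same first
    edge. *)
Lemma meeting_count m :
  (\sum_(g in C) \sum_y \sum_(s : m.-tuple E) \sum_z \sum_(t : m.-tuple E)
       (meeting g y z s t : nat)) * (N - (4 * m + 3))
  <= d.-1 * (#|C| * (N * d.-1 ^ (2 * m))).
Proof.
apply: (@leq_trans (d.-1 * \sum_(g in C) \sum_y \sum_(s : m.-tuple E) \sum_z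
   \sum_(t : m.-tuple E)
   ([&& path (follows g) y s, path (follows g) z t & last z t == last y s] : nat))).
  rewrite exchange_big [X in _ <= _ * X]exchange_big /=.
  rewrite big_distrl big_distrr; apply: leq_sum => y _ /=.
  rewrite exchange_big [X in _ <= _ * X]exchange_big /=.
  rewrite big_distrl big_distrr; apply: leq_sum => s _ /=.
  rewrite exchange_big [X in _ <= _ * X]exchange_big /=.
  rewrite big_distrl big_distrr; apply: leq_sum => z _ /=.
  rewrite exchange_big [X in _ <= _ * X]exchange_big /=.
  rewrite big_distrl big_distrr; apply: leq_sum => t _ /=.
  rewrite !sum_bool_card.
  have := @fresh_set (fun g => [&& path (follows g) y s, path (follows g) z t
       & last z t == last y s])
    (fun g => [set x | (initial x == initial (g y)) && (x != g y)]) d.-1 (y :: s ++ t) z.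
  rewrite /= size_cat !size_tuple (_ : (2 * _).+1 = 4 * m + 3); last by lia.
  move=> /(_ _ _ _)/(leq_trans _); apply => //.
  - rewrite leq_mul2r; apply/orP; right; apply: subset_leq_card.
    apply/fintype.subsetP => g /setIdP[gC /and5P[ys zt st yz /and3P[/eqP tyz zex zgex]]].
    apply/setIdP; split=> //.
    rewrite ys zt [last z t == _]eq_sym st zex zgex inE -/(terminal g z) -/(terminal g y) tyz eqxx.
    by rewrite (inj_eq perm_inj) eq_sym yz.
  - move=> g g' gg'; rewrite (@path_follows_local g g' y s) ?(@path_follows_local g g' z t) //.
      by move=> e et; apply: gg'; rewrite inE mem_cat et !orbT.
    by move=> e et; apply: gg'; rewrite inE mem_cat et !orbT.
  - by move=> g g' gg'; rewrite gg' ?mem_head.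
  - by move=> g gC _; rewrite card_other_half_edges.
rewrite leq_mul2l; apply/orP; right.
rewrite -sum_nat_const; apply: leq_sum => g gC.
rewrite -sum_nat_const; apply: leq_sum => y _.
rewrite mul2n -addnn expnD.
rewrite -{1}(@sum_path _ (follows g) d.-1 m y) => [|z]; last exact: sum_followed.
rewrite big_distrl; apply: leq_sum => s _ /=.
rewrite -(@sum_path_to _ (follows g) d.-1 m (last y s)) => [|z]; last exact: sum_follows.
rewrite big_distrr; apply: leq_sum => z _ /=.
rewrite big_distrr; apply: leq_sum => t _ /=.
by rewrite mulnb.
Qed.

(** * Loops and closed walks *)

Section Loops.
Variable g : pairing n d.

(** The relation [follows] read forwards in time, as closed walks are given
    with their earliest edge first. *)
Definition precedes (e f : E) : bool := follows g f e.

Definition nb_cycles k : {set k.-tuple E} := [set w : k.-tuple E | path.cycle precedes w].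

Lemma nb_cycles_trace k : 0 < k ->
  #|nb_cycles k| = \sum_x path_count (follows g) k x x.
Proof.
case: k => // k _; rewrite -sum_bool_cardT (sum_tuple_rev _ (fun w => path.cycle precedes w : nat)).
rewrite exchange_big /=; apply: eq_bigr => w _; rewrite rev_cycle.
case: (tupleP w) => y s; have -> := cycle_path y.
rewrite (bigD1 (last y s)) //= eqxx andbT big1 ?addn0 // => x.
by rewrite eq_sym => /negbTE ->; rewrite andbF.
Qed.

Lemma closed_walk_cycle (w : seq E) :
  is_closed_walk g w = (w != [::]) && path.cycle (fun e f => terminal g e == initial f) w.
Proof. by case: w => //= e s; rewrite rcons_path. Qed.

Section FixedLength.
Variable k : nat.
Implicit Types v w : k.-tuple E.

Lemma cyclic_class_refl w : 0 < k -> w \in cyclic_class w.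
Proof.
move=> k0; apply/imsetP; exists (Ordinal k0) => //.
by apply: val_inj; rewrite /= rot0.
Qed.

Lemma mem_cyclic_class v w : 0 < k ->
  reflect (exists2 i, i <= k & tval v = rot i w) (v \in cyclic_class w).
Proof.
move=> k0; apply: (iffP imsetP) => [[i _ ->]|[i ik vw]].
  by exists i => //; exact: ltnW.
have [lik|ki] := ltnP i k; first by exists (Ordinal lik) => //; apply: val_inj.
exists (Ordinal k0) => //; apply: val_inj; rewrite /= rot0 vw.
by rewrite rot_oversize ?size_tuple.
Qed.

Lemma cyclic_class_sub v w : 0 < k ->
  v \in cyclic_class w -> cyclic_class v \subset cyclic_class w.
Proof.
move=> k0 /(mem_cyclic_class _ _ k0)[i ik vw].
apply/fintype.subsetP => u /(mem_cyclic_class _ _ k0)[j jk uv].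
apply/mem_cyclic_class => //.
exists (if j + i <= k then j + i else j + i - k); first by case: (leqP (j + i) k) => // _; lia.
by rewrite uv vw rot_add_mod size_tuple.
Qed.

Lemma cyclic_class_eq v w : 0 < k ->
  v \in cyclic_class w -> cyclic_class v = cyclic_class w.
Proof.
move=> k0 vw; apply/eqP; rewrite eqEsubset !cyclic_class_sub //.
move: vw => /(mem_cyclic_class _ _ k0)[i ik vw].
apply/mem_cyclic_class => //; exists (k - i); first exact: leq_subr.
by rewrite vw -[in k - i](size_tuple w) -(size_rot i w) -/(rotr i _) rotK.
Qed.

Lemma card_cyclic_class w : #|cyclic_class w| <= k.
Proof. by rewrite (leq_trans (leq_imset_card _ _)) // card_ord. Qed.

Lemma card_cyclic_class_uniq w : uniq w -> #|cyclic_class w| = k.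
Proof.
move=> uw; rewrite card_imset ?card_ord // => i j /(congr1 val) /= ij.
have x0 : E := tnth w i.
have nth0 (l : 'I_k) : nth x0 (rot l w) 0 = nth x0 w l.
  by rewrite /rot nth_cat size_drop subn_gt0 size_tuple ltn_ord nth_drop addn0.
apply/val_inj/eqP; rewrite /= -(nth_uniq x0 _ _ uw) ?size_tuple ?ltn_ord //.
by rewrite -!nth0 ij.
Qed.

Lemma is_closed_walk_class v w : 0 < k -> v \in cyclic_class w ->
  is_closed_walk g v = is_closed_walk g w.
Proof.
move=> k0 /(mem_cyclic_class _ _ k0)[i _ vw].
by rewrite !closed_walk_cycle -!size_eq0 vw rot_cycle size_rot.
Qed.

Lemma loopsP (l : {set k.-tuple E}) w : 0 < k ->
  l \in loops g k -> w \in l -> l = cyclic_class w /\ is_closed_walk g w.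
Proof.
move=> k0 /imsetP[v]; rewrite inE => vc -> wv.
by rewrite (cyclic_class_eq k0 wv) (is_closed_walk_class k0 wv).
Qed.

(** A loop is the cyclic class of each of its walks, so that distinct loops
    share no walk. *)
Lemma loops_trivIset : 0 < k -> trivIset (loops g k).
Proof.
move=> k0; apply/trivIsetP => l l' lL l'L; apply: contraNT => /pred0Pn[w /andP[/= wl wl']].
by rewrite (loopsP k0 lL wl).1 (loopsP k0 l'L wl').1.
Qed.

Lemma N_simp_le_walks : 0 < k ->
  k * N_simp g k <=
  #|[set w : k.-tuple E | [&& is_closed_walk g w, nonbacktracking g w & simple g w]]|.
Proof.
move=> k0; rewrite /N_simp; set P := [set l in _ | _].
have Psub : P \subset loops g k by apply/fintype.subsetP => l /setIdP[].
have Pw (l : {set k.-tuple E}) w : l \in P -> w \in l ->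
    [/\ l = cyclic_class w, is_closed_walk g w, nonbacktracking g w & simple g w].
  move=> /setIdP[lL /andP[/forall_inP nbl /forall_inP sl]] wl.
  by have [lw cw] := loopsP k0 lL wl; split; [| | exact: nbl | exact: sl].
have cardP : \sum_(l in P) #|l| = k * #|P|.
  rewrite mulnC -sum_nat_const; apply: eq_bigr => l lP.
  have /imsetP[w _ lw] := fintype.subsetP Psub l lP.
  have wl : w \in l by rewrite lw cyclic_class_refl.
  have [_ _ _ sw] := Pw _ _ lP wl.
  by rewrite lw card_cyclic_class_uniq // (map_uniq sw).
have /eqP tP : trivIset P := trivIsetS Psub (loops_trivIset k0).
rewrite -cardP tP; apply: subset_leq_card; apply/fintype.subsetP => w /bigcupP[l lP wl].
by have [_ c nb s] := Pw _ _ lP wl; rewrite inE c nb s.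
Qed.

Definition repetitions : {set k.-tuple E} :=
  [set w : k.-tuple E | sorted precedes w && repetition_of_shorter g w].

(** A loop that is not primitive is the cyclic class of a walk that is a
    repetition; there are at most as many such loops as repetitions. *)
Lemma nb_cycles_le_loops : g \in C -> 0 < k ->
  #|nb_cycles k| <= k * (N_prim g k + #|repetitions|).
Proof.
move=> gC k0; pose P := [set l in loops g k | nonbacktracking_loop g l].
have cyc_sorted (w : k.-tuple E) : path.cycle precedes w -> is_closed_walk g w && nonbacktracking g w.
  rewrite closed_walk_cycle => cw; rewrite -size_eq0 size_tuple -lt0n k0 /=.
  have -> : path.cycle (fun e f => terminal g e == initial f) w.
    by apply: sub_cycle cw => e f /andP[].
  have : sorted precedes w.
    by case: (tval w) cw => //= e s; rewrite rcons_path => /andP[].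
  by apply: sub_sorted => e f /andP[].
have NP : nb_cycles k \subset cover P.
  apply/fintype.subsetP => w; rewrite inE => cw; apply/bigcupP.
  exists (cyclic_class w); last exact: cyclic_class_refl.
  have /andP[clw _] := cyc_sorted _ cw.
  rewrite inE; apply/andP; split; first by apply: imset_f; rewrite inE.
  apply/forall_inP => v /(mem_cyclic_class _ _ k0)[i _ vw].
  have : path.cycle precedes v by rewrite vw rot_cycle.
  by move=> /cyc_sorted/andP[].
apply: (leq_trans (subset_leq_card NP)); apply: (leq_trans (leq_card_cover _)).
apply: (@leq_trans (k * #|P|)).
  rewrite mulnC -sum_nat_const; apply: leq_sum => l /setIdP[/imsetP[w _ ->] _].
  exact: card_cyclic_class.
rewrite leq_mul2l; apply/orP; right.
have PU : P \subset [set l in loops g k | nonbacktracking_loop g l && primitive_loop g l]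
    :|: (@cyclic_class n d k) @: repetitions.
  apply/fintype.subsetP => l /setIdP[lL nbl]; rewrite inE.
  have [pl|/forall_inPn[w wl]] := boolP (primitive_loop g l); first by rewrite inE lL nbl pl.
  rewrite negbK => rw; apply/orP; right.
  have [lw cw] := loopsP k0 lL wl.
  apply/imsetP; exists w => //; rewrite inE rw andbT.
  have : nonbacktracking g w by move/forall_inP: nbl; apply.
  move: cw; rewrite /nonbacktracking /is_closed_walk /is_walk.
  case: (tval w) => // e s /andP[ws _] nbs.
  by rewrite (eq_sorted (e' := [rel e f | (terminal g e == initial f) && (reversed g e != f)])) // sorted_relI ws.
apply: (leq_trans (subset_leq_card PU)); apply: (leq_trans (leq_card_setU _ _)).
by rewrite leq_add2l leq_imset_card.
Qed.

End FixedLength.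

Lemma sorted_count m : g \in C ->
  #|[set v : m.+1.-tuple E | sorted precedes v]| = N * d.-1 ^ m.
Proof.
move=> gC; rewrite -sum_bool_cardT (sum_tuple_rev _ (fun v => sorted precedes v : nat)).
rewrite (sum_tuple_cons _ (fun v => sorted precedes (rev v) : nat)) -sum_nat_const.
apply: eq_bigr => y _.
rewrite -(@sum_path _ (follows g) d.-1 m y) => [|z]; last exact: sum_followed.
by apply: eq_bigr => s _; rewrite rev_sorted.
Qed.

(** A repetition of a walk of length [j <= k / 2] is determined by [j] and by
    its first [k / 2] edges. *)
Lemma card_repetitions k : g \in C -> 1 < d -> #|repetitions k| <= k * (N * d.-1 ^ k./2).
Proof.
move=> gC d1; set h := k./2.
have hk : h <= k by rewrite /h; lia.
have sz (w : k.-tuple E) : size (take h w) == h by rewrite size_takel ?size_tuple.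
pose f (w : k.-tuple E) : h.-tuple E := Tuple (sz w).
pose A (j : 'I_k) := [set w : k.-tuple E | [&& sorted precedes w, 0 < j <= h &
   tval w == flatten (nseq (k %/ j) (take j w))]].
have sub : repetitions k \subset \bigcup_(j : 'I_k) A j.
  apply/fintype.subsetP => w /setIdP[sw /existsP[j /existsP[u /existsP[r /andP[uc /eqP wu]]]]].
  apply/bigcupP; exists j => //.
  have j0 : 0 < j by case: (j) u uc {wu} => -[|//] ? u; rewrite (tuple0 u).
  have kr : k = r * j.
    have := size_tuple w; rewrite wu size_flatten /shape map_nseq size_tuple sumn_nseq.
    by rewrite mulnC => /esym.
  have r2 : 1 < r by have := ltn_ord j; rewrite ltnNge; nia.
  have uw : take j w = u.
    by rewrite wu; case: (nat_of_ord r) r2 => //= r' _; rewrite take_size_cat ?size_tuple.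
  have krj : k %/ j = r by apply/eqP; rewrite -(eqn_pmul2r j0) -kr divnK //; apply/dvdnP; exists r.
  rewrite inE sw j0 uw krj wu eqxx andbT /= /h.
  by move: kr r2 {krj uw wu}; nia.
apply: (leq_trans (subset_leq_card sub)).
apply: (@leq_trans (\sum_(j : 'I_k) #|A j|)).
  elim/big_ind2: _ => [|a B b D' aB bD|//]; first by rewrite cards0.
  by rewrite (leq_trans (leq_card_setU _ _)) ?leq_add.
rewrite -[k in k * _]card_ord -sum_nat_const; apply: leq_sum => j _.
(* For [k <= 1] there is no nonempty walk of length at most [k / 2]. *)
have [h0|h0] := posnP h.
  rewrite (_ : A j = set0) ?cards0 //; apply/setP => w; rewrite !inE h0.
  by case: (nat_of_ord j) => [|i]; rewrite ?andbF.
have f_inj : {in A j &, injective f}.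
  move=> v w; rewrite !inE => /and3P[_ /andP[_ jh] /eqP vE] /and3P[_ _ /eqP wE].
  move=> /(congr1 val) /= vw; apply: val_inj; rewrite /= vE wE.
  by rewrite -(take_takel v jh) vw take_takel.
rewrite -(card_in_imset f_inj).
apply: (@leq_trans #|[set v : h.-tuple E | sorted precedes v]|).
  apply: subset_leq_card; apply/fintype.subsetP => _ /imsetP[w /setIdP[sw _] ->].
  by rewrite inE /= take_sorted.
case: (h) h0 => // m _; rewrite sorted_count // leq_mul2l.
by rewrite leq_pexp2l ?orbT // -subn1 subn_gt0.
Qed.
End Loops.

(** In a closed walk the terminal vertices are the initial vertices, shifted
    by one, so that either may be required to be distinct. *)
Lemma simple_closed_rev (g : pairing n d) (y : E) (s : seq E) :
  [&& is_closed_walk g (rev (y :: s)), nonbacktracking g (rev (y :: s))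
    & simple g (rev (y :: s))]
  = simple_walk g y s && (terminal g y == initial (last y s)).
Proof.
rewrite closed_walk_cycle -size_eq0 size_rev /= rev_cycle (cycle_path y) /=.
rewrite /nonbacktracking rev_sorted /= /simple map_rev rev_uniq.
rewrite [_ == initial (last y s)]eq_sym /simple_walk.
set adj := fun f e => terminal g e == initial f.
have pathE : path (follows g) y s = path adj y s && path (fun f e => reversed g e != f) y s.
  exact: (path_relI adj).
rewrite pathE -!andbA.
have uE : initial (last y s) = terminal g y -> path adj y s ->
    uniq (map (terminal g) (y :: s)) = uniq (vertices (y :: s)).
  move=> ly ys.
  have -> : map (terminal g) (y :: s) = initial (last y s) :: vertices (belast y s).
    rewrite ly /=; congr cons; elim: s y ys {ly pathE} => //= z s IHs y /andP[/eqP-> zs].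
    by rewrite (IHs z).
  by rewrite [y :: s in RHS]lastI map_rcons rcons_uniq.
case: (initial (last y s) =P terminal g y) => [ly|_]; last by rewrite !andbF.
by case ys: (path adj y s) => //; rewrite uE // andbT.
Qed.

Lemma N_simp_le (g : pairing n d) m :
  m.+1 * N_simp g m.+1 <=
  \sum_y \sum_(s : m.-tuple E)
    (simple_walk g y s && (terminal g y == initial (last y s)) : nat).
Proof.
apply: (leq_trans (N_simp_le_walks g (ltn0Sn m))).
rewrite -sum_bool_cardT (sum_tuple_rev _ (fun w =>
  [&& is_closed_walk g w, nonbacktracking g w & simple g w] : nat)).
rewrite (sum_tuple_cons _ (fun w =>
  [&& is_closed_walk g (rev w), nonbacktracking g (rev w) & simple g (rev w)] : nat)).
by apply: leq_sum => y _; apply: leq_sum => s _; rewrite simple_closed_rev.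
Qed.

Lemma N_simp_gt (g : pairing n d) k : n < k -> N_simp g k = 0.
Proof.
case: k => // m nm; apply/eqP; rewrite -leqn0 -(leq_pmul2l (ltn0Sn m)) muln0.
apply: (leq_trans (N_simp_le g m)); rewrite leqn0; apply/eqP.
apply: big1 => y _; apply: big1 => s _; apply/eqP; rewrite eqb0.
apply: contraL nm => /andP[/andP[_ us] _]; rewrite -leqNgt.
by have := max_card [in vertices (y :: s)]; rewrite (card_uniqP us) card_ord /= size_map size_tuple.
Qed.

(** * Solving the recursions *)

Section Expectations.
Hypothesis d3 : 3 <= d.

Lemma sum_simple_count_le m : \sum_(g in C) simple_count g m <= #|C| * (N * d.-1 ^ m).
Proof. by rewrite -sum_nat_const; apply: leq_sum => g gC; apply: simple_count_le. Qed.

(** The bound solves the recursion [F (m+1) = D F m + (D - 1) D ^ (2 m + 1) N / K],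
    where [K] is a lower bound, valid for all the steps, on the number of unseen
    half-edges; it is multiplied by [K] to remain within the integers. *)
Lemma sum_pair_count M m : m <= M ->
  (\sum_(g in C) pair_count g m) * (N - (4 * M + 3))
  <= #|C| * N * ((N - (4 * M + 3)) * d.-1 ^ m + d.-1 ^ (2 * m)).
Proof.
elim: m => [|m IHm] mM.
  rewrite (eq_bigr (fun _ => N)) => [|g _]; last exact: pair_count0.
  by rewrite sum_nat_const leq_mul2l !expn0 muln1 leq_addr orbT.
have {IHm} := IHm (ltnW mM); set K := N - (4 * M + 3).
have := meeting_count m.
set H := \sum_(g in C) _ => HK.
have {}HK : H * K <= d.-1 * (#|C| * (N * d.-1 ^ (2 * m))).
  by apply: leq_trans HK; rewrite leq_mul2l /K; apply/orP; right; lia.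
have FH : \sum_(g in C) pair_count g m.+1 <= d.-1 * \sum_(g in C) pair_count g m + d.-2 * H.
  rewrite /H !big_distrr -big_split /=; apply: leq_sum => g gC.
  exact: pair_countS.
have [D' dD] : exists D', d = D'.+2 by exists d.-2; lia.
move: FH HK.
have -> : d.-2 = D' by lia.
have -> : d.-1 = D'.+1 by lia.
rewrite mulnS expnD -mulnn expnS.
move: (_ ^ m) (_ ^ (2 * m)) (\sum_(g in C) _) (\sum_(g in C) _) (#|C|) => P P2 F F' c.
move: H K N => H K N'.
move=> FH HK IH.
apply: (leq_trans (leq_mul FH (leqnn K))).
have {}HK : D' * (H * K) <= D' * (D'.+1 * (c * (N' * P2))) by rewrite leq_mul2l HK orbT.
have {}IH : D'.+1 * (F * K) <= D'.+1 * (c * N' * (K * P + P2)) by rewrite leq_mul2l IH orbT.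
lia.
Qed.

(** The failure probabilities [d (j + 1) / K] of the steps add up to at most
    [d m ^ 2 / K]. *)
Lemma sum_simple_count_ge M m : m <= M ->
  #|C| * N * d.-1 ^ m * (N - (4 * M + 3))
  <= (\sum_(g in C) simple_count g m) * (N - (4 * M + 3))
     + #|C| * N * d.-1 ^ m * (d * m ^ 2).
Proof.
elim: m => [|m IHm] mM.
  rewrite (eq_bigr (fun _ => N)) => [|g _]; last exact: simple_count0.
  by rewrite sum_nat_const expn0 muln1 leq_addr.
have {IHm} := IHm (ltnW mM); set K := N - (4 * M + 3).
have := @simple_count_grow m K; rewrite {1}/K => /(_ _)/wrap[]; first lia.
have := sum_simple_count_le m.
rewrite !expnS expn0 muln1.
move: (d.-1) (d.-1 ^ m) (\sum_(g in C) _) (\sum_(g in C) _) (#|C|) K N => D P G' G c K N'.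
move=> Gle grow IH.
have {}Gle : D * (d * m.+1) * G <= D * (d * m.+1) * (c * (N' * P)) by rewrite leq_mul2l Gle orbT.
have {}IH : D * (c * N' * P * K) <= D * (G * K + c * N' * P * (d * (m * m))).
  by rewrite leq_mul2l IH orbT.
have : 0 <= D * c * N' * P * d * m by [].
lia.
Qed.

(** The factor lost at each step is at least [1 - (m + 2) / N].  Instead of
    an exponential, the induction uses
    [(1 - x) / (1 + S) <= 1 / (1 + S + x)], which leaves the decay
    [1 / (1 + m ^ 2 / (2 N))]. *)
Lemma sum_simple_count_decay m : m < n ->
  (\sum_(g in C) simple_count g m) * (2 * N + m ^ 2)
  <= 2 * N * (#|C| * (N * d.-1 ^ m)).
Proof.
elim: m => [|m IHm] mn.
  rewrite addn0 mulnC leq_mul2l; apply/orP; right; exact: sum_simple_count_le.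
have {IHm} := IHm (ltnW mn).
have := simple_count_decay m.
set G' := \sum_(g in C) _; set G := \sum_(g in C) _ => dec IH.
have NE := card_half_edge.
have K0 : 0 < N - (2 * m).+1 by nia.
have N0 : 0 < N by lia.
rewrite -(leq_pmul2r (m := (N - (2 * m).+1) * N)) ?muln_gt0 ?K0 //.
have key : d * (n - m.+1) * N * (2 * N + m.+1 ^ 2) <=
   (N - (2 * m).+1) * N * (2 * N + m ^ 2).
  (* As [d (n - m - 1) = N - d (m + 1)], this rests on [d (m + 1) >= 3 m + 3]. *)
  have s1 : d * (n - m.+1) * N <= (N - (2 * m).+1) * (N - (m + 2)).
    rewrite NE; have [p np] : exists p, n = p + m.+1 by exists (n - m.+1); lia.
    have -> : n - m.+1 = p by lia.
    rewrite np mulnDl.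
    have le3 : m.+1 * 3 <= m.+1 * d by rewrite leq_mul2l d3 orbT.
    have [r rE] : exists r, m.+1 * d = 3 * m + 3 + r.
      by exists (m.+1 * d - (3 * m + 3)); lia.
    rewrite rE [d * p]mulnC; move: (p * d) => q.
    have -> : q + (3 * m + 3 + r) - (2 * m).+1 = q + r + m + 2 by lia.
    have -> : q + (3 * m + 3 + r) - (m + 2) = q + r + 2 * m + 1 by lia.
    have [? ? ? ?] : [/\ 0 <= q * r, 0 <= r * r, 0 <= r * m & 0 <= m * m] by [].
    lia.
  apply: (leq_trans (leq_mul s1 (leqnn _))); rewrite -!mulnA leq_mul2l; apply/orP; right.
  have : m + 2 <= N by nia.
  move: (N) => N'; rewrite !expnS !expn0 !muln1 => mN.
  have [q ->] : exists q, N' = q + (m + 2) by exists (N' - (m + 2)); lia.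
  have : 0 <= (m + 2) * (2 * (m + 2) + m * m) by [].
  rewrite addnK; lia.
rewrite (expnS d.-1).
move: dec IH key K0 N0; move: (N - _) (2 * N + m.+1 ^ 2) (2 * N + m ^ 2).
move: (d * (n - m.+1)) (d.-1) (d.-1 ^ m) #|C| N => a D P c N' K X Y dec IH key _ _.
apply: (@leq_trans (D * a * G * (X * N'))).
  by have := leq_mul dec (leqnn (X * N')); lia.
apply: (@leq_trans (D * G * (K * N' * Y))).
  by have := leq_mul (leqnn (D * G)) key; lia.
by have := leq_mul (leqnn (D * (K * N'))) IH; lia.
Qed.

(** Closing up is a fresh step into one of the [d] half-edges at the starting
    vertex, while at least [n] half-edges are unseen. *)
Lemma sum_N_simp m : m < n ->
  (\sum_(g in C) m.+1 * N_simp g m.+1) * (n * (2 * N + m ^ 2))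
  <= d * (2 * N * (#|C| * (N * d.-1 ^ m))).
Proof.
move=> mn.
have NE := card_half_edge.
have := sum_simple_closed m.
set Z := \sum_(g in C) _ => ZG.
have SZ : \sum_(g in C) m.+1 * N_simp g m.+1 <= Z.
  by apply: leq_sum => g _; apply: N_simp_le.
have nK : n <= N - (2 * m).+1 by nia.
apply: leq_trans (leq_mul (leqnn d) (sum_simple_count_decay mn)).
rewrite !mulnA; apply: leq_mul => //.
by apply: leq_trans ZG; apply: leq_mul.
Qed.

End Expectations.
End ConfigModel.

(** * Closed walks from the Hilbert-Schmidt distance to uniform *)

Local Open Scope ring_scope.

(** If [q] is close to the constant [c], then [q q r] has nearly the trace that
    the constant matrix would give.  Pointwise,
    [a b >= phi a + phi b] with [phi a = 2 c a - c ^ 2 - a ^ 2 / 2], which is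
    [(a + b - 2 c) ^ 2 >= 0]; double stochasticity of [r] removes it from each of
    the two sums. *)
Lemma trace_bound (R : realFieldType) (T : finType) (q r : T -> T -> R) (rho c : R) :
  (forall z x, 0 <= r z x) ->
  (forall z, \sum_x r z x = rho) -> (forall x, \sum_z r z x = rho) ->
  rho * (4 * c * (\sum_x \sum_y q x y) - 2 * (c * #|T|%:R) ^+ 2
         - \sum_x \sum_y q x y ^+ 2)
  <= \sum_x \sum_y \sum_z q x y * q y z * r z x.
Proof.
move=> r0 rows cols; pose phi a := 2 * c * a - c ^+ 2 - a ^+ 2 / 2.
have phiE : \sum_x \sum_y phi (q x y) =
    2 * c * (\sum_x \sum_y q x y) - (c * #|T|%:R) ^+ 2
    - (\sum_x \sum_y q x y ^+ 2) / 2.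
  rewrite /phi (eq_bigr (fun x => 2 * c * (\sum_y q x y) - c ^+ 2 * #|T|%:R
     - (\sum_y q x y ^+ 2) / 2)) => [|x _].
    rewrite !sumrB -mulr_sumr; congr (_ - _ - _); last by rewrite mulr_suml.
    by rewrite sumr_const -(mulr_natr (_ * _)) exprMn -mulrA -expr2.
  rewrite !sumrB -mulr_sumr; congr (_ - _ - _); last by rewrite mulr_suml.
  by rewrite sumr_const -(mulr_natr (c ^+ 2)).
have left : \sum_x \sum_y \sum_z phi (q x y) * r z x = rho * \sum_x \sum_y phi (q x y).
  rewrite mulr_sumr; apply: eq_bigr => x _; rewrite mulr_sumr; apply: eq_bigr => y _.
  by rewrite -mulr_sumr cols mulrC.
have right : \sum_x \sum_y \sum_z phi (q y z) * r z x = rho * \sum_x \sum_y phi (q x y).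
  rewrite exchange_big mulr_sumr; apply: eq_bigr => y _.
  rewrite exchange_big mulr_sumr; apply: eq_bigr => z _ /=.
  by rewrite -mulr_sumr rows mulrC.
have -> : rho * (4 * c * (\sum_x \sum_y q x y) - 2 * (c * #|T|%:R) ^+ 2
         - \sum_x \sum_y q x y ^+ 2) =
    rho * (\sum_x \sum_y phi (q x y)) + rho * (\sum_x \sum_y phi (q x y)).
  by rewrite phiE; field.
rewrite -{1}left -right -big_split; apply: ler_sum => x _ /=.
rewrite -big_split; apply: ler_sum => y _ /=.
rewrite -big_split; apply: ler_sum => z _ /=.
rewrite -mulrDl ler_wpM2r // /phi.
have := sqr_ge0 (q x y + q y z - 2 * c); nra.
Qed.

Lemma markov_count (R : realFieldType) (I : finType) (A : {set I}) (f : I -> R) a :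
  (forall i, i \in A -> 0 <= f i) ->
  a * #|[set i in A | a < f i]|%:R <= \sum_(i in A) f i.
Proof.
move=> f0; rewrite mulr_natr -sumr_const big_mkcond [leRHS]big_mkcond /=.
apply: ler_sum => i _; rewrite inE; case: (boolP (i \in A)) => //= iA.
by case: ltP => // [/ltW|] //; rewrite f0.
Qed.

Section Finite.
Variables (R : realType) (n d : nat).
Notation E := (half_edge n d).
Notation N := #|{: E}|.
Notation C := (config_model n d).
Local Notation D := (d.-1%:R : R).
Hypothesis d3 : (3 <= d)%N.

Let Dpos : 0 < D.
Proof. by rewrite ltr0n; lia. Qed.

Definition simple_path_count (g : pairing n d) m (x y : E) : nat :=
  (\sum_(s : m.-tuple E) (simple_walk g x s && (last x s == y) : nat))%N.

Lemma sum_simple_path_count g m :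
  (\sum_x \sum_y simple_path_count g m x y = simple_count g m)%N.
Proof.
apply: eq_bigr => x _; rewrite exchange_big; apply: eq_bigr => s _.
rewrite (bigD1 (last x s)) //= eqxx andbT big1 ?addn0 // => y.
by rewrite eq_sym => /negbTE ->; rewrite andbF.
Qed.

Lemma sum_simple_path_count_sqr g m :
  (\sum_x \sum_y simple_path_count g m x y ^ 2 = pair_count g m)%N.
Proof.
apply: eq_bigr => x _.
under eq_bigr => y _ do rewrite -mulnn big_distrl /=.
rewrite exchange_big; apply: eq_bigr => s _ /=.
under eq_bigr => y _ do rewrite big_distrr /=.
rewrite exchange_big; apply: eq_bigr => t _ /=.
rewrite (bigD1 (last x s)) //= eqxx andbT big1 ?addn0 => [|y].
  by rewrite mulnb eq_sym.
by rewrite eq_sym => /negbTE ->; rewrite andbF.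
Qed.

Lemma simple_path_count_le g m x y :
  (simple_path_count g m x y <= path_count (follows g) m x y)%N.
Proof.
apply: leq_sum => s _; rewrite /simple_walk.
by case: path; case: uniq; case: (_ == y).
Qed.

(** A closed walk of length [2 m + b] is cut into two walks of [m] steps, of
    which only the simple ones are kept, and a walk of [b] steps. *)
Lemma nb_cycles_ge_defect g m b : g \in C -> (0 < m)%N -> (0 < N)%N ->
  D ^+ b * (4 * (D ^+ m / N%:R) * (simple_count g m)%:R - 2 * (D ^+ m) ^+ 2
            - (pair_count g m)%:R)
  <= #|nb_cycles g (m + m + b)|%:R.
Proof.
move=> gC m0 N0; rewrite nb_cycles_trace; last by rewrite !addn_gt0 m0.
have N0' : N%:R != 0 :> R by rewrite pnatr_eq0 -lt0n.
have := @trace_bound R E (fun x y => (simple_path_count g m x y)%:R)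
  (fun x y => (path_count (follows g) b x y)%:R) (D ^+ b) (D ^+ m / N%:R).
rewrite divfK //.
have -> : \sum_x \sum_y (simple_path_count g m x y)%:R = (simple_count g m)%:R :> R.
  by rewrite -sum_simple_path_count natr_sum; apply: eq_bigr => x _; rewrite natr_sum.
have -> : \sum_x \sum_y (simple_path_count g m x y)%:R ^+ 2 = (pair_count g m)%:R :> R.
  rewrite -sum_simple_path_count_sqr natr_sum; apply: eq_bigr => x _; rewrite natr_sum.
  by apply: eq_bigr => y _; rewrite natrX.
move=> tr; apply: (le_trans (tr _ _ _)) => [//|x|y|].
- by rewrite -natr_sum (@path_count_row _ _ d.-1) ?natrX // => z; apply: sum_followed.
- by rewrite -natr_sum (@path_count_col _ _ d.-1) ?natrX // => z; apply: sum_follows.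
rewrite natr_sum; apply: ler_sum => x _.
rewrite -addnA path_countD natr_sum; apply: ler_sum => y _.
rewrite path_countD natrM natr_sum mulr_sumr; apply: ler_sum => z _.
rewrite natrM mulrA ler_wpM2r // -!natrM ler_nat leq_mul //; exact: simple_path_count_le.
Qed.

(** Up to scaling, [1] minus the lower bound that [trace_bound] gives for the
    trace. *)
Definition defect (g : pairing n d) m : R :=
  3 * (D ^+ m) ^+ 2 + (pair_count g m)%:R
  - 4 * (D ^+ m / N%:R) * (simple_count g m)%:R.

(** The defect is the squared distance from the matrix of simple walks to
    the uniform one, plus a multiple of the deficit of its total mass. *)
Lemma defect_ge0 g m : g \in C -> (0 < N)%N -> 0 <= defect g m.
Proof.
move=> gC N0; rewrite /defect; set c := D ^+ m / N%:R.
have Nr : 0 < N%:R :> R by rewrite ltr0n.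
have c0 : 0 <= c by rewrite divr_ge0 ?exprn_ge0 ?ltW.
have cN : D ^+ m = c * N%:R by rewrite divfK // gt_eqF.
have S1 : c * (simple_count g m)%:R <= (D ^+ m) ^+ 2.
  rewrite expr2 {1}cN -mulrA ler_wpM2l // -natrX -natrM ler_nat.
  exact: simple_count_le.
have : 0 <= \sum_x \sum_y ((simple_path_count g m x y)%:R - c) ^+ 2.
  by apply: sumr_ge0 => x _; apply: sumr_ge0 => y _; apply: sqr_ge0.
have -> : \sum_x \sum_y ((simple_path_count g m x y)%:R - c) ^+ 2 =
    (pair_count g m)%:R - 2 * c * (simple_count g m)%:R + (D ^+ m) ^+ 2.
  rewrite -sum_simple_path_count_sqr -sum_simple_path_count !natr_sum mulr_sumr cN.
  rewrite -sumrN -big_split /=.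
  have -> : (c * N%:R) ^+ 2 = \sum_(x : E) (c ^+ 2 * N%:R).
    by rewrite sumr_const -mulr_natr; ring.
  rewrite -big_split; apply: eq_bigr => x _ /=.
  rewrite !natr_sum mulr_sumr -sumrN -big_split /= mulr_natr -sumr_const -big_split.
  by apply: eq_bigr => y _ /=; rewrite natrX; ring.
lra.
Qed.

Lemma sum_defect m (K := (N - (4 * m + 3))%N) : (0 < K)%N ->
  \sum_(g in C) defect g m <= #|C|%:R * (D ^+ m) ^+ 2 *
    (N%:R / D ^+ m + (N%:R / K%:R - 1) + 4 * d%:R * m%:R ^+ 2 / K%:R).
Proof.
move=> K0; have N0 : (0 < N)%N by rewrite /K in K0; lia.
have Kr : 0 < K%:R :> R by rewrite ltr0n.
have Nr : 0 < N%:R :> R by rewrite ltr0n.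
have Dm : 0 < D ^+ m by rewrite exprn_gt0.
have -> : \sum_(g in C) defect g m = #|C|%:R * (3 * (D ^+ m) ^+ 2)
    + (\sum_(g in C) pair_count g m)%:R
    - 4 * (D ^+ m / N%:R) * (\sum_(g in C) simple_count g m)%:R.
  rewrite /defect sumrB big_split /= sumr_const -(mulr_natl (_ * _)) -mulr_sumr.
  by rewrite !natr_sum.
have := sum_pair_count n d3 (leqnn m); rewrite -/K mulnC [(2 * m)%N]mulnC expnM.
rewrite -(ler_nat R) !natrM natrD natrM !natrX.
have := sum_simple_count_ge n d3 (leqnn m); rewrite -/K.
rewrite -(ler_nat R) natrD !natrM !natrX.
set S := (\sum_(g in C) simple_count g m)%:R.
set F := (\sum_(g in C) pair_count g m)%:R.
move: S F => S F.
move: Kr Nr Dm; move: K%:R N%:R (D ^+ m) #|C|%:R d%:R m%:R => k N' P c d' m'.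
move=> k0 N'0 P0 SG FG.
have {}SG : c * P * (1 - d' * m' ^+ 2 / k) <= S / N'.
  rewrite ler_pdivlMr // -(ler_pM2r k0).
  have -> : c * P * (1 - d' * m' ^+ 2 / k) * N' * k = c * N' * P * k - c * N' * P * (d' * m' ^+ 2).
    by field; rewrite gt_eqF.
  by rewrite lerBlDr.
have {}FG : F <= c * P ^+ 2 * (N' / P + N' / k).
  rewrite -(ler_pM2l k0); apply: (le_trans FG); rewrite le_eqVlt; apply/orP; left.
  by apply/eqP; field; rewrite !gt_eqF.
have {}SG := ler_wpM2l (ltW P0) SG.
have -> : c * P ^+ 2 * (N' / P + (N' / k - 1) + 4 * d' * m' ^+ 2 / k) =
   3 * P ^+ 2 * c + c * P ^+ 2 * (N' / P + N' / k) - 4 * (P * (c * P * (1 - d' * m' ^+ 2 / k))).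
  by ring.
have -> : 4 * (P / N') * S = 4 * (P * (S / N')) by ring.
rewrite -[c * _]mulrC; lra.
Qed.

(** Outside two exceptional sets of graphs, each controlled by Markov's
    inequality, the defect is at most [D ^ (2 m) / 2] and [k * N_simp] is at most
    [eps * D ^ k / 4].  On the other graphs [D ^ k / 2] closed walks are left,
    of which the hypothesis on [k] allows at most half to be lost to
    repetitions. *)
Lemma config_prob_bounds m k eps (K := (N - (4 * m + 3))%N) :
  (0 < #|C|)%N -> 0 < eps -> (0 < m)%N -> (0 < K)%N -> (2 * m <= k)%N ->
  (4 * (k * k * (N * d.-1 ^ k./2)) <= d.-1 ^ k)%N ->
  1 - (2 * (N%:R / D ^+ m + (N%:R / K%:R - 1) + 4 * d%:R * m%:R ^+ 2 / K%:R)
       + 8 * d%:R ^+ 3 * n%:R / (eps * k.-1%:R ^+ 2))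
  <= config_prob R (fun g : pairing n d => (N_simp g k)%:R <= eps * (N_prim g k)%:R) <= 1.
Proof.
move=> C0 eps0 m0 K0 mk repk.
have d1 : (1 < d)%N := ltnW d3.
have k2 : (2 <= k)%N by rewrite (leq_trans _ mk) // leq_pmulr.
have c0 : 0 < #|C|%:R :> R by rewrite ltr0n.
apply/andP; split; last first.
  rewrite /config_prob ler_pdivrMr // mul1r ler_nat subset_leq_card //.
  by apply/fintype.subsetP => g /setIdP[].
have N0 : (0 < N)%N by move: K0; rewrite /K; lia.
have Nr : 0 < N%:R :> R by rewrite ltr0n.
have D1 : 1 <= D by rewrite (ler_nat R 1); lia.
set v := N%:R / D ^+ m + _ + _; set w := 8 * _ * _ / _.
have w0 : 0 <= w by rewrite divr_ge0 ?mulr_ge0 ?exprn_ge0 // ltW.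
pose V := [set g in C | (D ^+ m) ^+ 2 / 2 < defect g m].
pose W := [set g in C | eps * D ^+ k / 4 < (k * N_simp g k)%:R].
have V_le : #|V|%:R <= 2 * v * #|C|%:R.
  have Dm : 0 < (D ^+ m) ^+ 2 by rewrite !exprn_gt0.
  have := markov_count ((D ^+ m) ^+ 2 / 2)
    (fun g (gC : g \in C) => defect_ge0 m gC N0).
  move=> /le_trans/(_ (sum_defect K0)); rewrite -/v => le2.
  rewrite -(ler_pM2l (divr_gt0 Dm (ltr0Sn R 1))).
  apply: (le_trans le2); rewrite le_eqVlt; apply/orP; left; apply/eqP.
  by field.
have W_le : #|W|%:R <= w * #|C|%:R.
  (* A simple loop has at most [n] edges; the estimate for [k <= n] needs unseen
     half-edges at every step. *)
  have [nk|kn] := ltnP n k.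
    have -> : W = finset.set0.
      apply/finset.setP => g; rewrite !inE N_simp_gt // muln0.
      by rewrite ltNge divr_ge0 ?andbF // mulr_ge0 ?exprn_ge0 // ltW.
    by rewrite cards0; apply: mulr_ge0.
  have [j kj] : exists j, k = j.+2 by exists (k - 2)%N; rewrite -addn2 subnK.
  have := @markov_count R _ C (fun g => (k * N_simp g k)%:R) (eps * D ^+ k / 4) (fun _ _ => ler0n _ _).
  rewrite -/W -natr_sum => mk1.
  have := @sum_N_simp n d d3 j.+1; rewrite -kj => /(_ kn).
  set S := (\sum_(g in C) k * N_simp g k)%N in mk1 *.
  rewrite -(ler_nat R) !natrM natrD !natrM !natrX card_half_edge natrM => Sle.
  have n0 : 0 < n%:R :> R by rewrite ltr0n (leq_trans _ kn) // ltnW.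
  have dr : 0 < d%:R :> R by rewrite ltr0n ltnW.
  have j0 : 0 < j.+1%:R :> R by rewrite ltr0n.
  have Sle2 : S%:R * (j.+1%:R ^+ 2) <= 2 * d%:R ^+ 3 * n%:R * #|C|%:R * D ^+ k.
    rewrite -(ler_pM2l n0).
    apply: le_trans (_ : 2 * d%:R ^+ 3 * n%:R ^+ 2 * #|C|%:R * D ^+ j.+1 <= _).
      apply: le_trans (_ : S%:R * (n%:R * (2 * (n%:R * d%:R) + j.+1%:R ^+ 2)) <= _).
        rewrite mulrCA ler_wpM2l // ler_pM2l // lerDr.
        by rewrite !mulr_ge0 // ltW.
      apply: (le_trans Sle); rewrite le_eqVlt; apply/orP; left; apply/eqP; ring.
    have -> : D ^+ k = D * D ^+ j.+1 by rewrite kj exprS.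
    have := @ler_wpM2r R (2 * d%:R ^+ 3 * n%:R ^+ 2 * #|C|%:R * D ^+ j.+1) _ 1 D D1.
    rewrite mul1r => /(_ _)/le_trans; apply.
      by rewrite !mulr_ge0 ?exprn_ge0 // ltW.
    rewrite le_eqVlt; apply/orP; left; apply/eqP; ring.
  have Dk : 0 < D ^+ k by rewrite exprn_gt0.
  rewrite /w kj /= -(ler_pM2l (_ : 0 < eps * D ^+ k / 4 * j.+1%:R ^+ 2)); last first.
    by rewrite !mulr_gt0 // ?exprn_gt0 // invr_gt0.
  have -> : eps * D ^+ k / 4 * j.+1%:R ^+ 2 * (8 * d%:R ^+ 3 * n%:R / (eps * j.+1%:R ^+ 2) * #|C|%:R)
     = 2 * d%:R ^+ 3 * n%:R * #|C|%:R * D ^+ k.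
    by field; rewrite !gt_eqF.
  apply: le_trans Sle2; rewrite mulrAC ler_wpM2r // exprn_ge0 // ltW.
have good : C \subset [set g in C | (N_simp g k)%:R <= eps * (N_prim g k)%:R] :|: (V :|: W).
  apply/fintype.subsetP => g gC; apply/finset.setUP.
  case: (ltP ((D ^+ m) ^+ 2 / 2) (defect g m)) => Vg.
    by right; apply/finset.setUP; left; apply/finset.setIdP.
  case: (ltP (eps * D ^+ k / 4) (k * N_simp g k)%:R) => Wg.
    by right; apply/finset.setUP; right; apply/finset.setIdP.
  left; apply/finset.setIdP; split=> //.
  have [b kb] : exists b, k = (m + m + b)%N
    by exists (k - (m + m))%N; rewrite subnKC // addnn -mul2n.
  have k0 : (0 < k)%N := ltnW k2.
  have T1 := @nb_cycles_ge_defect g m b gC m0 N0; rewrite -kb in T1.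
  have Dk : D ^+ k = D ^+ b * (D ^+ m) ^+ 2 by rewrite kb !exprD; ring.
  have T2 : D ^+ k / 2 <= #|nb_cycles g k|%:R.
    apply: le_trans T1; rewrite Dk -mulrA ler_wpM2l ?exprn_ge0 ?(ltW Dpos) //.
    by move: Vg; rewrite /defect; lra.
  have T3 : #|nb_cycles g k|%:R <= k%:R * (N_prim g k)%:R + D ^+ k / 4.
    have := nb_cycles_le_loops gC k0; rewrite -(ler_nat R) => /le_trans; apply.
    rewrite mulnDr natrD natrM lerD2l ler_pdivlMr // -natrX -natrM ler_nat.
    apply: leq_trans repk; rewrite mulnC leq_mul2l /= -mulnA leq_mul2l.
    by rewrite card_repetitions ?orbT.
  rewrite -(ler_pM2l (_ : 0 < k%:R)) ?ltr0n //.
  have T4 : D ^+ k / 4 <= k%:R * (N_prim g k)%:R by lra.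
  have := ler_wpM2l (ltW eps0) T4.
  move: Wg; rewrite natrM; lra.
have := leq_trans (subset_leq_card good) (leq_card_setU _ _).
move=> /leq_trans/(_ (leq_add (leqnn _) (leq_card_setU _ _))).
rewrite /config_prob -(ler_nat R) !natrD => le1.
rewrite ler_pdivlMr // mulrBl mul1r mulrDl; lra.
Qed.
End Finite.
(** * Asymptotics *)

(** With [b = a + 1] and [q = m / b] one has [q ^ b <= 2 ^ (q b) <= 2 ^ m],
    while [m <= 2 b q] once [m >= b]; the spare factor [m] absorbs the constant. *)
Lemma poly_le_exp2 (A a : nat) :
  exists M, forall m, (M <= m)%N -> (A * m ^ a <= 2 ^ m)%N.
Proof.
set b := a.+1; exists (b + A * (2 * b) ^ b)%N => m mM.
have bpos : (0 < (2 * b) ^ b)%N by rewrite expn_gt0 muln_gt0.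
pose q := (m %/ b)%N.
have qb : (q * b <= m)%N by exact: leq_trunc_div.
have q1 : (0 < q)%N by rewrite divn_gt0 // (leq_trans _ mM) ?leq_addr.
have mq : (m <= 2 * b * q)%N.
  have := ltn_ceil m (ltn0Sn a); rewrite -/q -/b mulSn => /ltnW/leq_trans; apply.
  by rewrite -mulnA mul2n -addnn [(b * q)%N]mulnC leq_add2r leq_pmull.
rewrite -(leq_pmul2l bpos); apply: (@leq_trans (m ^ b)%N).
  rewrite [(m ^ b)%N]expnS mulnCA mulnA leq_mul2r; apply/orP; right.
  by rewrite (leq_trans _ mM) ?leq_addl.
apply: (@leq_trans ((2 * b * q) ^ b)%N); first by rewrite leq_exp2r.
rewrite expnMn leq_mul2l; apply/orP; right.
apply: (@leq_trans ((2 ^ q) ^ b)%N); first by rewrite leq_exp2r // ltnW // ltn_expl.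
by rewrite -expnM leq_exp2l.
Qed.

Lemma fourth_root (n : nat) : exists m, (m ^ 4 <= n < m.+1 ^ 4)%N.
Proof.
elim: n => [|n [m /andP[mn nm]]]; first by exists 0%N.
have [lt|ge] := ltnP n.+1 (m.+1 ^ 4); first by exists m; rewrite lt ltnW.
by exists m.+1; rewrite ge (leq_ltn_trans nm) // ltn_exp2r.
Qed.

(** For [m] close to the fourth root of [n], each of the three errors in the
    defect is [O (d / m)]; the number [7] comes from [4 m + 3 <= 7 m]. *)
Lemma config_prob_bounds_root (R : realType) (n d m k : nat) (eps : R) :
  (3 <= d)%N -> ~~ odd (n * d) -> 0 < eps -> (2 <= m)%N ->
  (m ^ 4 <= n < m.+1 ^ 4)%N -> (n <= k ^ 2)%N ->
  (64 * d * m ^ 6 <= 2 ^ m)%N -> (64 * d * (uphalf k) ^ 6 <= 2 ^ uphalf k)%N ->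
  1 - (24 * d%:R / m%:R + 32 * d%:R ^+ 3 * n%:R / (eps * k%:R ^+ 2))
  <= config_prob R (fun g : pairing n d => (N_simp g k)%:R <= eps * (N_prim g k)%:R) <= 1.
Proof.
move=> d3 evenN eps0 m2 /andP[mn nm] nk expm expk.
have NE : #|{: half_edge n d}| = (n * d)%N := card_half_edge n d.
have m0 : (0 < m)%N := ltnW m2.
have mm : (m ^ 2 <= k)%N.
  by rewrite -(@leq_exp2r _ _ 2) // -expnM (leq_trans mn).
have mk : (2 * m <= k)%N by rewrite (leq_trans _ mm) // -mulnn leq_mul2r m2 orbT.
have k2 : (2 <= k)%N by rewrite (leq_trans _ mk) // leq_pmulr.
have n8 : (8 * m <= n)%N.
  rewrite (leq_trans _ mn) // expnSr leq_mul2r; apply/orP; right.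
  by rewrite (@leq_exp2r 2 m 3).
have nK : (n <= n * d - (4 * m + 3))%N.
  have : (n * 3 <= n * d)%N by rewrite leq_mul2l d3 orbT.
  move: n8 m2; clear; lia.
have n0 : (0 < n)%N by rewrite (leq_trans _ n8) // muln_gt0.
have D2 : (2 <= d.-1)%N by rewrite -ltnS (ltn_predK d3).
have D0 : (0 < d.-1)%N := ltnW D2.
have rep : (4 * (k * k * (n * d * d.-1 ^ k./2)) <= d.-1 ^ k)%N.
  have kE : (uphalf k + k./2)%N = k by rewrite uphalf_half -addnA addnn odd_double_half.
  have -> : (d.-1 ^ k = d.-1 ^ uphalf k * d.-1 ^ k./2)%N by rewrite -expnD kE.
  rewrite !mulnA leq_mul2r; apply/orP; right.
  have h2 : (2 ^ uphalf k <= d.-1 ^ uphalf k)%N by case: (uphalf k) => // h; rewrite leq_exp2r.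
  apply: leq_trans h2; apply: leq_trans expk.
  have kh : (k <= 2 * uphalf k)%N by rewrite mul2n -leq_uphalf_double.
  have h0 : (0 < uphalf k)%N by rewrite uphalf_gt0 ltnW.
  apply: (@leq_trans (4 * d * (k ^ 4))%N).
    have -> : (4 * k * k * n * d = 4 * d * (k ^ 2 * n))%N by rewrite -mulnn; ring.
    by rewrite leq_mul2l (_ : (k ^ 4 = k ^ 2 * k ^ 2)%N) ?leq_mul2l ?nk ?orbT // -expnD.
  apply: (@leq_trans (4 * d * ((2 * uphalf k) ^ 4))%N).
    by rewrite leq_mul2l leq_exp2r // kh orbT.
  have -> : (4 * d * (2 * uphalf k) ^ 4 = 64 * d * uphalf k ^ 4)%N by rewrite expnMn; ring.
  by rewrite leq_mul2l leq_pexp2l ?orbT.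
have := @config_prob_bounds R n d d3 m k eps.
rewrite NE => /(_ (config_model_gt0 evenN) eps0 m0 (leq_trans n0 nK) mk rep)/andP[lo up].
rewrite up andbT; apply: le_trans lo; rewrite lerD2l lerN2.
apply: lerD.
  set K := (n * d - (4 * m + 3))%N in nK *.
  have mr : 0 < m%:R :> R by rewrite ltr0n.
  have Kr : 0 < K%:R :> R by rewrite ltr0n (leq_trans n0 nK).
  have Dm : 0 < d.-1%:R ^+ m :> R by rewrite exprn_gt0 // ltr0n.
  have mK a : (a <= 4)%N -> m%:R ^+ a <= K%:R :> R.
    by move=> a4; rewrite -natrX ler_nat (leq_trans _ nK) // (leq_trans _ mn) // leq_pexp2l.
  have first_term : (n * d)%:R / d.-1%:R ^+ m <= 1 / m%:R :> R.
    rewrite ler_pdivrMr // mulrC mulrA mulr1 ler_pdivlMr // -natrX -natrM ler_nat.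
    have Dexp : (2 ^ m <= d.-1 ^ m)%N by rewrite leq_exp2r.
    apply: leq_trans Dexp; apply: leq_trans expm.
    apply: (@leq_trans ((2 * m) ^ 4 * d * m)%N).
      rewrite !leq_mul2r; apply/orP; right; apply/orP; right.
      rewrite (leq_trans (ltnW nm)) // leq_exp2r // mul2n -addnn -[m.+1]addn1.
      by rewrite leq_add2l.
    have -> : ((2 * m) ^ 4 * d * m = 16 * d * m ^ 5)%N by rewrite expnMn; ring.
    by apply: leq_mul; rewrite ?leq_mul2r ?orbT // leq_pexp2l.
  have second_term : (n * d)%:R / K%:R - 1 <= 7 / m%:R :> R.
    have -> : (n * d)%:R = K%:R + (4 * m + 3)%:R :> R.
      rewrite -natrD /K subnK //; apply: ltnW; rewrite -subn_gt0.
      exact: leq_trans n0 nK.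
    rewrite mulrDl divff ?gt_eqF // addrC addKr ler_pdivrMr // mulrC mulrA ler_pdivlMr //.
    have := mK 2%N isT; rewrite natrD natrM expr2.
    have : 1 <= m%:R :> R by rewrite (ler_nat R 1).
    nra.
  have third_term : 4 * d%:R * m%:R ^+ 2 / K%:R <= 4 * d%:R / m%:R :> R.
    rewrite ler_pdivrMr // [leRHS]mulrAC ler_pdivlMr // -[leLHS]mulrA ler_wpM2l ?mulr_ge0 //.
    by rewrite -exprSr mK.
  have d1 : 1 <= d%:R :> R by rewrite (ler_nat R 1) ltnW // ltnW.
  have -> : 24 * d%:R / m%:R = 24 * (d%:R / m%:R) :> R by rewrite mulrA.
  have : 1 / m%:R <= d%:R / m%:R :> R by rewrite ler_pM2r ?invr_gt0.
  move: first_term second_term third_term; rewrite -!mulrA mul1r.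
  lra.
have kr : 0 < k%:R :> R by rewrite ltr0n ltnW.
have kk : k%:R <= 2 * k.-1%:R :> R.
  by rewrite -natrM ler_nat; case: (k) k2 => [|[|j]] // _; clear; rewrite /=; lia.
have k1 : 0 < k.-1%:R :> R by lra.
rewrite ler_pdivrMr ?mulr_gt0 ?exprn_gt0 // [leRHS]mulrAC ler_pdivlMr ?mulr_gt0 ?exprn_gt0 //.
have : k%:R ^+ 2 <= (2 * k.-1%:R) ^+ 2 :> R by rewrite ler_pXn2r // nnegrE ?mulr_ge0 // ltW.
have c0 : 0 <= 8 * d%:R ^+ 3 * n%:R * eps by rewrite !mulr_ge0 ?exprn_ge0 // ltW.
move=> /(ler_wpM2l c0); rewrite exprMn.
nra.
Qed.

Local Open Scope classical_set_scope.
Local Open Scope ring_scope.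

Theorem theorem1p2 (R : realType) (d : nat) (k : nat -> nat) (eps : R) :
  (3 <= d)%N ->
  (forall n : nat, admissible d n -> (0 < k n)%N) ->
  (Num.sqrt n%:R / (k n)%:R : R) @[n --> admissible_oo d] --> (0 : R) ->
  0 < eps ->
  config_prob R (fun g : pairing n d =>
      (N_simp g (k n))%:R <= eps * (N_prim g (k n))%:R)
    @[n --> admissible_oo d] --> (1 : R).
Proof.
move=> d3 kpos kbig eps0.
have dr : 0 < d%:R :> R by rewrite ltr0n ltnW // ltnW.
apply/cvgrPdist_le => /= eta eta0.
have [M expM] := poly_le_exp2 (64 * d) 6.
(* The bound [1] on [delta] gives [n <= k ^ 2]; the other makes the error that
   comes from the simple loops at most [eta / 2], as [delta ^ 2 <= delta]. *)
pose delta : R := Num.min 1 (eta * eps / (64 * d%:R ^+ 3)).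
have delta0 : 0 < delta.
  by rewrite lt_min ltr01 divr_gt0 ?mulr_gt0 ?exprn_gt0.
have delta1 : delta <= 1 by rewrite ge_min lexx.
pose M2 := (Num.truncn (48 * d%:R / eta)).+1.
pose M' := (M + 2 + M2)%N.
have : \forall n \near admissible_oo d, `|0 - Num.sqrt n%:R / (k n)%:R| <= delta.
  by move/cvgrPdist_le: kbig; apply.
rewrite !near_withinE => kbig'.
have nbig : \forall n \near \oo, (M' ^ 4 <= n)%N by exact: nbhs_infty_ge.
near=> n => /= adm.
have evenN : ~~ odd (n * d).
  by move: adm; rewrite /admissible oddM; case: (odd d); rewrite /= ?andbF // andbT.
have Mn : (M' ^ 4 <= n)%N by near: n.
have kn : `|0 - Num.sqrt n%:R / (k n)%:R| <= delta by move: adm; near: n.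
have k0 : 0 < (k n)%:R :> R by rewrite ltr0n kpos.
have nk2 : n%:R <= delta ^+ 2 * (k n)%:R ^+ 2.
  move: kn; rewrite sub0r normrN ger0_norm ?divr_ge0 ?sqrtr_ge0 //.
  rewrite ler_pdivrMr // => kn.
  rewrite -exprMn -(@sqr_sqrtr R n%:R) // ler_pXn2r ?nnegrE ?sqrtr_ge0 //.
  by rewrite mulr_ge0 // ltW.
have [m mP] := fourth_root n.
have mM : (M' <= m)%N.
  by move: mP => /andP[_ nm]; rewrite -ltnS -(@ltn_exp2r _ _ 4) // (leq_ltn_trans Mn).
have m2 : (2 <= m)%N by rewrite (leq_trans _ mM) // /M' -addnA addnCA leq_addr.
have Mm : (M <= m)%N by rewrite (leq_trans _ mM) // /M' -addnA leq_addr.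
have nk : (n <= k n ^ 2)%N.
  rewrite -(ler_nat R) natrX (le_trans nk2) // ler_piMl ?exprn_ge0 //.
  by rewrite exprn_ile1 // ltW.
have mk : (m <= uphalf (k n))%N.
  have mm : (m ^ 2 <= k n)%N.
    by rewrite -(@leq_exp2r _ _ 2) // -expnM (leq_trans _ nk) //; case/andP: mP.
  rewrite uphalfE geq_half_double (leq_trans _ (leqW mm)) //.
  by rewrite -mulnn -mul2n leq_mul2r m2 orbT.
have := config_prob_bounds_root d3 evenN eps0 m2 mP nk (expM _ Mm) (expM _ (leq_trans Mm mk)).
move=> /andP[lo up].
rewrite ger0_norm ?subr_ge0 // lerBlDr -lerBlDl; apply: le_trans lo.
rewrite lerD2l lerN2 (splitr eta); apply: lerD.
  have mr : 0 < m%:R :> R by rewrite ltr0n ltnW.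
  have : 48 * d%:R / eta <= m%:R.
    rewrite (le_trans (ltW (truncnS_gt _))) // ler_nat (leq_trans _ mM) //.
    exact: leq_addl.
  rewrite ler_pdivrMr // => dm; rewrite ler_pdivrMr //; lra.
rewrite ler_pdivrMr ?mulr_gt0 ?exprn_gt0 //.
have deltale : delta ^+ 2 <= eta * eps / (64 * d%:R ^+ 3).
  apply: (@le_trans _ _ delta); last by rewrite ge_min lexx orbT.
  by rewrite expr2 ler_piMl // ltW.
have {}nk2 : n%:R <= eta * eps / (64 * d%:R ^+ 3) * (k n)%:R ^+ 2.
  by rewrite (le_trans nk2) // ler_wpM2r // exprn_ge0 // ltW.
have c0 : 0 <= 32 * d%:R ^+ 3 :> R by rewrite mulr_ge0 // exprn_ge0 // ltW.
apply: (le_trans (ler_wpM2l c0 nk2)); rewrite le_eqVlt; apply/orP; left; apply/eqP.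
by field; rewrite gt_eqF.
Unshelve. all: by end_near.
Qed.
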